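(* Let $P$ be a smooth lattice polytope. The following properties are equivalent: 1. $P$ is deeply smooth. 2. The first displacement of every face $F$ of $P$ is normally isomorphic to $F$. 3. $P$ and the first displacements of all its faces are UT-free.
   Context: An $n$-dimensional polytope in $\mathbb{R}^n$ is smooth if it is simple, rational, and the primitive edge-direction vectors at each vertex form a basis of $\mathbb{Z}^n$; it is a lattice polytope if its vertices are in $\mathbb{Z}^n$. For a vertex $v$ of a smooth lattice polytope $P$ with primitive edge vectors $u_1,\dots,u_n$ at $v$ (pointing away from $v$), the corner parallelepiped at $v$ is $\{v+\sum_{i=1}^n\lambda_iu_i:\lambda_i\in[0,1]\ \forall i\}$. $P$ is deeply smooth if it contains the corner parallelepipeds at all its vertices. Let $F$ be a face of codimension $k$ of a smooth lattice polytope $P$, obtained as the intersection of $k$ facets with facet inequalities $u_i\cdot x\le b_i$, $i=1,\dots,k$, with $u_i\in\mathbb{Z}^n$ primitive. The first displacement of $F$ is the polytope $P\cap\{x\in\mathbb{R}^n: u_i\cdot x=b_i-1\ \forall i=1,\dots,k\}$. Two polytopes in the same ambient space are normally isomorphic if they have the same normal fan. A lattice polytope is UT-free if none of its $2$-dimensional faces (including the polytope itself if it is $2$-dimensional) is a unimodular triangle, i.e. a lattice triangle whose edge vectors at a vertex form a basis of the two-dimensional lattice of integer vectors parallel to its plane. *)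

(* Defs.v *)
From mathcomp Require Import all_boot all_order all_algebra.
From mathcomp Require Import boolp classical_sets cardinality reals.

Set Implicit Arguments.
Unset Strict Implicit.
Unset Printing Implicit Defensive.

Import Order.TTheory GRing.Theory Num.Theory.

Local Open Scope classical_set_scope.
Local Open Scope ring_scope.

Definition dot (R : realType) (n : nat) (u x : 'rV[R]_n) : R :=
  \sum_(i < n) u 0 i * x 0 i.

Definition of_int (R : realType) (m n : nat) (A : 'M[int]_(m, n)) : 'M[R]_(m, n) :=
  map_mx intr A.
Arguments of_int R {m n} A.

Definition primitive (n : nat) (u : 'rV[int]_n) : Prop :=
  \big[gcdn/0%N]_(i < n) absz (u 0 i) = 1%N.

(* The rows of U form a Z-basis of the sublattice L of Z^n. *)
Definition lattice_basis (n k : nat) (L : set 'rV[int]_n) (U : 'M[int]_(k, n)) : Prop :=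
  (forall i, L (row i U)) /\
  (forall w, L w -> exists! c : 'rV[int]_k, c *m U = w).

(* Convex hull of the rows of A. *)
Definition hull (R : realType) (m n : nat) (A : 'M[R]_(m, n)) : set 'rV[R]_n :=
  [set l *m A | l in [set l : 'rV[R]_m | (forall i, 0 <= l 0 i) /\ \sum_i l 0 i = 1]].

Definition polytope (R : realType) (n : nat) (P : set 'rV[R]_n) : Prop :=
  exists m (A : 'M[R]_(m, n)), P = hull A.

(* The rows of U form a basis of the direction space of the affine hull of S,
   the smallest linear subspace containing all differences of points of S;
   hence the empty set has no dimension. *)
Definition has_dim (R : realType) (n : nat) (S : set 'rV[R]_n) (d : nat) : Prop :=
  S !=set0 /\
  exists U : 'M[R]_(d, n), row_free U /\
    forall W : 'M[R]_n,
      (U <= W)%MS <-> (forall x y, S x -> S y -> (x - y <= W)%MS).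

Definition has_codim (R : realType) (n : nat) (S : set 'rV[R]_n) (k : nat) : Prop :=
  exists2 d, (d + k)%N = n & has_dim S d.

(* Faces are nonempty, and P is a face of itself (take c = 0 and b = 0). *)
Definition face (R : realType) (n : nat) (P F : set 'rV[R]_n) : Prop :=
  F !=set0 /\
  exists (c : 'rV[R]_n) (b : R),
    (forall x, P x -> dot c x <= b) /\ F = P `&` [set x | dot c x = b].

Definition vertex (R : realType) (n : nat) (P : set 'rV[R]_n) (v : 'rV[R]_n) : Prop :=
  face P [set v].

Definition edge (R : realType) (n : nat) (P E : set 'rV[R]_n) : Prop :=
  face P E /\ has_dim E 1.

Definition facet (R : realType) (n : nat) (P F : set 'rV[R]_n) : Prop :=
  face P F /\ has_codim F 1.

(* u . x <= b is the facet inequality, with primitive integer normal u,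
   of the facet F. *)
Definition facet_ineq (R : realType) (n : nat) (P F : set 'rV[R]_n)
    (u : 'rV[int]_n) (b : R) : Prop :=
  [/\ facet P F, primitive u, (forall x, P x -> dot (of_int R u) x <= b)
    & F = P `&` [set x | dot (of_int R u) x = b]].

Definition simple_polytope (R : realType) (n : nat) (P : set 'rV[R]_n) : Prop :=
  forall v, vertex P v -> ([set F | facet P F /\ F v] #= `I_n)%card.

Definition rational_polytope (R : realType) (n : nat) (P : set 'rV[R]_n) : Prop :=
  forall F, facet P F -> exists u b, facet_ineq P F u b.

(* w is the primitive direction, pointing away from v, of an edge of P at v. *)
Definition edge_vector (R : realType) (n : nat) (P : set 'rV[R]_n) (v : 'rV[R]_n)
    (w : 'rV[int]_n) : Prop :=
  primitive w /\
  exists2 E, edge P E /\ E v & exists2 t : R, 0 < t & E (v + t *: of_int R w).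

(* The rows of U list the primitive edge vectors of P at v without repetition. *)
Definition edge_frame (R : realType) (n : nat) (P : set 'rV[R]_n) (v : 'rV[R]_n)
    (U : 'M[int]_n) : Prop :=
  injective (fun i => row i U) /\
  (forall w, edge_vector P v w <-> exists i, row i U = w).

Definition smooth (R : realType) (n : nat) (P : set 'rV[R]_n) : Prop :=
  [/\ polytope P, has_dim P n, simple_polytope P, rational_polytope P
    & forall v, vertex P v -> exists2 U, edge_frame P v U & lattice_basis setT U].

Definition lattice_polytope (R : realType) (n : nat) (P : set 'rV[R]_n) : Prop :=
  polytope P /\ forall v, vertex P v -> exists w : 'rV[int]_n, v = of_int R w.

Definition corner (R : realType) (n : nat) (v : 'rV[R]_n) (U : 'M[int]_n) :
    set 'rV[R]_n :=
  [set v + l *m of_int R U | l in [set l : 'rV[R]_n | forall i, 0 <= l 0 i <= 1]].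

Definition deeply_smooth (R : realType) (n : nat) (P : set 'rV[R]_n) : Prop :=
  forall v U, vertex P v -> edge_frame P v U -> corner v U `<=` P.

(* D is the first displacement of the face F of P. For P smooth, F lies on exactly
   codim F facets, so such a D exists and is unique; it may be empty. *)
Definition first_displacement (R : realType) (n : nat) (P F D : set 'rV[R]_n) : Prop :=
  exists (k : nat) (G : 'I_k -> set 'rV[R]_n) (u : 'I_k -> 'rV[int]_n) (b : 'I_k -> R),
    [/\ has_codim F k, injective G, (forall i, facet_ineq P (G i) (u i) (b i)),
        F = P `&` [set x | forall i, G i x]
      & D = P `&` [set x | forall i, dot (of_int R (u i)) x = b i - 1]].

Definition normal_cone (R : realType) (n : nat) (P F : set 'rV[R]_n) : set 'rV[R]_n :=
  [set c | forall x y, F x -> P y -> dot c y <= dot c x].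

Definition normal_fan (R : realType) (n : nat) (P : set 'rV[R]_n) : set (set 'rV[R]_n) :=
  [set normal_cone P F | F in face P].

Definition normally_isomorphic (R : realType) (n : nat) (P Q : set 'rV[R]_n) : Prop :=
  normal_fan P = normal_fan Q.

Definition unimodular_triangle (R : realType) (n : nat) (T : set 'rV[R]_n) : Prop :=
  exists (a : 'rV[int]_n) (U : 'M[int]_(2, n)),
    T = hull (of_int R (col_mx a (\matrix_i (a + row i U)))) /\
    lattice_basis [set w | (of_int R w <= of_int R U)%MS] U.

Definition ut_free (R : realType) (n : nat) (P : set 'rV[R]_n) : Prop :=
  forall F, face P F -> has_dim F 2 -> ~ unimodular_triangle F.

(* Main.v *)
Require Import Defs.
From mathcomp Require Import all_boot all_order all_algebra perm.
From mathcomp Require Import boolp classical_sets cardinality reals.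
From mathcomp Require Import zify ring lra.

(** The primitive edge vectors [e_1, ..., e_n] at a vertex [v] of a smooth lattice
    polytope [P] form a basis of the lattice, so they give integer coordinates [y] centred at
    [v].  In these coordinates [P] lies in the nonnegative orthant and contains the unit
    vectors, the facets through [v] are the sets [y_j = 0], and a face [F] through [v] has
    the form [y_J = 0] for a set [J] of indices; its first displacement [D] is then the part
    of [P] where [y_J = 1].  Such a system of coordinates is called a chart below.  That [P]
    lies in the orthant is [edge_vector_decreasing]: a functional that decreases somewhere
    from [v] decreases along an edge at [v].

    Suppose that [P] is deeply smooth.  Let [c] be a functional, and let [v] be a vertex at
    which [c] is maximal on [F].  The corner parallelepiped at [v] contains
    [q = v + sum_J e_j] and all points [q + e_j] with [j] outside [J].  So near [q] the
    polytope [D] looks like [F] near [v], [c] is maximal on [D] at [q], and the normal cones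
    of the faces of [F] and [D] selected by [c] are described by the same inequalities
    ([normal_cone_chart]); hence the normal fans agree ([deeply_smooth_fan]).  By the same
    token a two-dimensional face of [D] contains a lattice parallelogram at [q], whereas a
    unimodular triangle has only three lattice points ([deeply_smooth_ut_free]).

    Conversely, one shows by induction on the size of [S] that [v + sum_S e_j] lies in [P],
    for all vertices [v] at once.  Take two indices [a], [b] in [S], let [T] be the rest, and
    look at the polygon [y = 1] on [T], [y = 0] off [S].  By induction it contains the
    lattice points (0,0), (1,0) and (0,1) of the (a,b)-plane, as well as the corresponding
    points for the neighbours of [v] along [e_a] and [e_b].  Comparing the charts at the two
    ends of an edge ([chart_neighbor]) shows that the polygon contains (1,1) unless it is the
    unimodular triangle with these three vertices ([corner_or_long]).  Such a triangle is a
    face of the first displacement of the face [y_T = 0], so it is excluded when displacements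
    are UT-free ([triangle_ut]).  It is also excluded when displacements have the fans of their
    faces ([triangle_fan]): the first displacement of the face where [y = 0] on [T] and [a]
    meets the polygon in the point (1,0), whereas that face itself has an edge at [v] in the
    direction [e_b]. *)

Set Implicit Arguments.
Unset Strict Implicit.
Unset Printing Implicit Defensive.

Import Order.TTheory GRing.Theory Num.Theory.

Local Open Scope classical_set_scope.
Local Open Scope ring_scope.

(** * Linear functionals on convex hulls *)

Lemma dotE (R : realType) n (u x : 'rV[R]_n) : dot u x = (x *m u^T) 0 0.
Proof. by rewrite mxE; apply: eq_bigr => i _; rewrite mxE mulrC. Qed.

Lemma dotDr (R : realType) n (u x y : 'rV[R]_n) : dot u (x + y) = dot u x + dot u y.
Proof. by rewrite !dotE mulmxDl mxE. Qed.

Lemma dotNr (R : realType) n (u x : 'rV[R]_n) : dot u (- x) = - dot u x.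
Proof. by rewrite !dotE mulNmx mxE. Qed.

Lemma dotBr (R : realType) n (u x y : 'rV[R]_n) : dot u (x - y) = dot u x - dot u y.
Proof. by rewrite dotDr dotNr. Qed.

Lemma dotZr (R : realType) n (u x : 'rV[R]_n) a : dot u (a *: x) = a * dot u x.
Proof. by rewrite !dotE -scalemxAl mxE. Qed.

Lemma dotC (R : realType) n (u x : 'rV[R]_n) : dot u x = dot x u.
Proof. by apply: eq_bigr => i _; rewrite mulrC. Qed.

Lemma dotDl (R : realType) n (u x y : 'rV[R]_n) : dot (x + y) u = dot x u + dot y u.
Proof. by rewrite dotC dotDr !(dotC u). Qed.

Lemma dotNl (R : realType) n (u x : 'rV[R]_n) : dot (- x) u = - dot x u.
Proof. by rewrite dotC dotNr dotC. Qed.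

Lemma dotZl (R : realType) n (u x : 'rV[R]_n) a : dot (a *: x) u = a * dot x u.
Proof. by rewrite dotC dotZr dotC. Qed.

Lemma dot_mulmx (R : realType) m n (u : 'rV[R]_n) (l : 'rV[R]_m) (A : 'M[R]_(m, n)) :
  dot u (l *m A) = \sum_i l 0 i * dot u (row i A).
Proof.
rewrite dotE -mulmxA mxE; apply: eq_bigr => i _; congr (_ * _).
by rewrite dotE -row_mul [RHS]mxE.
Qed.

Lemma dot_sq_ge0 (R : realType) n (x : 'rV[R]_n) : 0 <= dot x x.
Proof. by apply: sumr_ge0 => i _; rewrite -expr2 sqr_ge0. Qed.

Lemma dot_sq_eq0 (R : realType) n (x : 'rV[R]_n) : dot x x = 0 -> x = 0.
Proof.
move=> /eqP; rewrite psumr_eq0 => [/allP x0|i _]; last by rewrite -expr2 sqr_ge0.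
apply/rowP => i; rewrite mxE; apply/eqP.
by have := x0 i (mem_index_enum i); rewrite mulf_eq0 orbb.
Qed.

Lemma hull_row (R : realType) m n (A : 'M[R]_(m, n)) i : hull A (row i A).
Proof.
exists (delta_mx 0 i); last by rewrite -rowE.
split=> [j|]; first by rewrite mxE eqxx ler0n.
by rewrite (bigD1 i) //= big1 ?mxE ?eqxx ?addr0 // => j /negPf; rewrite mxE eqxx => ->.
Qed.

Lemma hull_convex (R : realType) m n (A : 'M[R]_(m, n)) x y t :
  0 <= t <= 1 -> hull A x -> hull A y -> hull A ((1 - t) *: x + t *: y).
Proof.
move=> /andP[t0 t1] [l [l0 l1] <-] [k [k0 k1] <-].
exists ((1 - t) *: l + t *: k); last by rewrite mulmxDl -!scalemxAl.
split=> [i|]; first by rewrite !mxE addr_ge0 // mulr_ge0 ?subr_ge0.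
under eq_bigr do rewrite !mxE.
by rewrite big_split /= -!mulr_sumr l1 k1 !mulr1 subrK.
Qed.

Lemma polytope_convex (R : realType) n (P : set 'rV[R]_n) x y t :
  polytope P -> 0 <= t <= 1 -> P x -> P y -> P ((1 - t) *: x + t *: y).
Proof. by move=> [m [A ->]]; apply: hull_convex. Qed.

Lemma hull_le (R : realType) m n (A : 'M[R]_(m, n)) f b x :
  (forall i, dot f (row i A) <= b) -> hull A x -> dot f x <= b.
Proof.
move=> fA [l [l0 l1] <-]; rewrite dot_mulmx -[b]mul1r -l1 mulr_suml.
by apply: ler_sum => i _; rewrite ler_wpM2l.
Qed.

Lemma hull_tight (R : realType) m n (A : 'M[R]_(m, n)) f b (l : 'rV[R]_m) :
  (forall i, dot f (row i A) <= b) -> (forall i, 0 <= l 0 i) -> \sum_i l 0 i = 1 ->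
  dot f (l *m A) = b -> forall i, l 0 i != 0 -> dot f (row i A) = b.
Proof.
move=> fA l0 l1 lb i li.
have : \sum_i l 0 i * (b - dot f (row i A)) = 0.
  under eq_bigr do rewrite mulrBr.
  by rewrite sumrB -mulr_suml l1 mul1r -dot_mulmx lb subrr.
move=> /eqP; rewrite psumr_eq0 => [/allP /(_ i (mem_index_enum i))|k _]; last first.
  by rewrite mulr_ge0 ?subr_ge0.
by rewrite mulf_eq0 (negPf li) subr_eq0 => /eqP.
Qed.

Lemma sum1_neq0 (R : realType) m (l : 'rV[R]_m) : \sum_i l 0 i = 1 -> exists i, l 0 i != 0.
Proof.
move=> l1; apply: contrapT => /forallNP h; move: l1; rewrite big1 => [/esym/eqP|i _].
  by rewrite oner_eq0.
by apply/eqP/negPn/negP/h.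
Qed.

Lemma hull_index (R : realType) m n (A : 'M[R]_(m, n)) x : hull A x -> 'I_m.
Proof.
case: m A => [|m] A; last by move=> _; exact: ord0.
by move=> hx; exfalso; case: hx => l [_ /eqP]; rewrite big_ord0 eq_sym oner_eq0.
Qed.

Lemma argmax_ord (R : realType) m (g : 'I_m -> R) (p : pred 'I_m) (i0 : 'I_m) : p i0 ->
  exists2 i, p i & forall j, p j -> g j <= g i.
Proof. by move=> pi0; case: (@arg_maxP _ _ _ i0 p g pi0) => i pi h; exists i. Qed.

Definition argmax (R : realType) n (P : set 'rV[R]_n) (c : 'rV[R]_n) : set 'rV[R]_n :=
  [set x | P x /\ forall z, P z -> dot c z <= dot c x].

Lemma faceP (R : realType) n (P F : set 'rV[R]_n) :
  face P F <-> F !=set0 /\ exists c, F = argmax P c.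
Proof.
split=> -[[x0 Fx0]].
- move=> [c [b [cb FE]]]; split; first by exists x0.
  move: Fx0; rewrite FE => -[Px0 /= cx0].
  exists c; apply/seteqP; split=> x /= [Px cx]; split=> //.
    by move=> z Pz; rewrite cx; apply: cb.
  by apply/eqP; rewrite eq_le cb //= -cx0 cx.
- move=> [c FE]; split; first by exists x0.
  move: Fx0; rewrite FE => -[Px0 cx0].
  exists c, (dot c x0); split=> //; apply/seteqP; split=> x /= [Px cx]; split=> //.
    by apply/eqP; rewrite eq_le cx0 //= cx.
  by move=> z Pz; rewrite cx cx0.
Qed.

Lemma argmax_neq0 (R : realType) n (P : set 'rV[R]_n) c :
  polytope P -> P !=set0 -> argmax P c !=set0.
Proof.
move=> [m [A ->]] [x hx].
have [i _ hi] := @argmax_ord _ _ (fun i => dot c (row i A)) xpredT (hull_index hx) isT.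
exists (row i A); split; first exact: hull_row.
by move=> z; apply: hull_le => k; apply: hi.
Qed.

Lemma argmax_face (R : realType) n (P : set 'rV[R]_n) c :
  polytope P -> P !=set0 -> face P (argmax P c).
Proof. by move=> pP P0; apply/faceP; split; [exact: argmax_neq0|exists c]. Qed.

(** Replacing every listed point off the face by one fixed point of the face
    keeps the number of points, so no reindexing is needed. *)
Lemma face_polytope (R : realType) n (P F : set 'rV[R]_n) :
  polytope P -> face P F -> polytope F.
Proof.
move=> [m [A ->]] [[x0 Fx0] [c [b [cb FE]]]].
move: Fx0; rewrite FE => -[[l [l0 l1] <-]] /= cl.
have cA i : dot c (row i A) <= b by apply: cb; exact: hull_row.
have tight := hull_tight cA.
have [i0 li0] := sum1_neq0 l1.
have ci0 := tight _ l0 l1 cl _ li0.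
pose B := \matrix_i (if dot c (row i A) == b then row i A else row i0 A).
exists m, B.
have rB i : row i B = if dot c (row i A) == b then row i A else row i0 A by rewrite rowK.
have cB i : dot c (row i B) = b by rewrite rB; case: ifP => [/eqP|].
apply/seteqP; split=> x.
- move=> [[k [k0 k1] <-]] /= ck; exists k => //.
  rewrite !mulmx_sum_row; apply: eq_bigr => i _.
  have [->|ki] := eqVneq (k 0 i) 0; first by rewrite !scale0r.
  by rewrite rB (tight _ k0 k1 ck) ?eqxx.
- move=> [k [k0 k1] <-]; split; last first.
    by rewrite /= dot_mulmx; under eq_bigr do rewrite cB; rewrite -mulr_suml k1 mul1r.
  exists (\row_j \sum_(i | (if dot c (row i A) == b then i else i0) == j) k 0 i).
    split=> [i|]; first by rewrite mxE sumr_ge0.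
    under eq_bigr do rewrite mxE.
    by rewrite -k1 [RHS](partition_big (fun i => if dot c (row i A) == b then i else i0) xpredT).
  rewrite !mulmx_sum_row; under eq_bigr do rewrite mxE scaler_suml.
  rewrite [RHS](partition_big (fun i => if dot c (row i A) == b then i else i0) xpredT) //=.
  apply: eq_bigr => j _; apply: eq_bigr => i /eqP <-.
  by rewrite rB; case: ifP.
Qed.

(** A large multiple of the functional cutting out the face dominates the
    functional that cuts out the smaller face inside it. *)
Lemma face_trans (R : realType) n (P F H : set 'rV[R]_n) :
  polytope P -> face P F -> face F H -> face P H.
Proof.
move=> [m [A ->]] [_ [c [b [cb FE]]]] [[x0 Hx0] [d [e [de HE]]]].
split; first by exists x0.
have cA i : dot c (row i A) <= b by apply: cb; exact: hull_row.
pose M := \sum_i `|dot d (row i A) - e| / `|b - dot c (row i A)|.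
exists (d + (M + 1) *: c), (e + (M + 1) * b).
have key x : hull A x -> dot d x + M * dot c x <= e + M * b.
  rewrite -dotZl -dotDl; apply: hull_le => i; rewrite dotDl dotZl.
  have := cA i; rewrite le_eqVlt => /orP[/eqP ci|ci].
    by rewrite ci lerD2r de // FE; split=> //; exact: hull_row.
  have bc : 0 < b - dot c (row i A) by rewrite subr_gt0.
  have : `|dot d (row i A) - e| / `|b - dot c (row i A)| <= M.
    by rewrite /M (bigD1 i) //= lerDl sumr_ge0 // => k _; rewrite divr_ge0.
  rewrite (gtr0_norm bc) ler_pdivrMr // => h.
  have := ler_norm (dot d (row i A) - e).
  move: h; set N := `|_|; nra.
split=> [x Px|].
  have := key x Px; have := cb x Px; rewrite dotDl dotZl; lra.
rewrite HE FE; apply/seteqP; split=> x /=.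
  by move=> [[Px cx] dx]; rewrite dotDl dotZl cx dx.
move=> [Px]; rewrite dotDl dotZl => h.
have := key x Px; have := cb x Px => h1 h2.
have cx : dot c x = b by lra.
by split=> //; move: h h2; rewrite cx; lra.
Qed.

(** The longest of the spanning points is exposed by itself as a functional. *)
Lemma vertex_exists (R : realType) n (P : set 'rV[R]_n) :
  polytope P -> P !=set0 -> exists v, vertex P v.
Proof.
move=> [m [A ->]] [x hx].
have [i _ hi] := @argmax_ord _ _ (fun i => dot (row i A) (row i A)) xpredT (hull_index hx) isT.
set a := row i A in hi *; exists a.
have sq k : dot (row k A - a) (row k A - a)
    = dot (row k A) (row k A) - 2 * dot a (row k A) + dot a a.
  by rewrite dotBr !dotDl !dotNl (dotC _ a); ring.
have aA k : dot a (row k A) <= dot a a.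
  by have := sq k; have := dot_sq_ge0 (row k A - a); have := hi k isT; lra.
split; first by exists a.
exists a, (dot a a); split=> [y|]; first exact: hull_le.
apply/seteqP; split=> y /=; first by move=> ->; split=> //; exact: hull_row.
move=> [[l [l0 l1] <-]] al.
rewrite mulmx_sum_row -[RHS]scale1r -l1 scaler_suml; apply: eq_bigr => k _.
have [->|lk] := eqVneq (l 0 k) 0; first by rewrite !scale0r.
have ak := hull_tight aA l0 l1 al lk.
congr (_ *: _); apply/eqP; rewrite -subr_eq0; apply/eqP/dot_sq_eq0.
by apply/eqP; rewrite eq_le dot_sq_ge0 andbT sq ak; have := hi k isT; lra.
Qed.

Lemma argmax_vertex (R : realType) n (P : set 'rV[R]_n) c :
  polytope P -> P !=set0 -> exists2 v, vertex P v & argmax P c v.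
Proof.
move=> pP P0; have fF := argmax_face c pP P0.
have [v vv] := vertex_exists (face_polytope pP fF) (argmax_neq0 c pP P0).
exists v; first exact: face_trans fF vv.
by case: vv => _ [d [e [_ vE]]]; have : [set v] v by []; rewrite vE => -[].
Qed.

(** * Edges at a vertex *)

Lemma has_dim_basis (R : realType) n d (S : set 'rV[R]_n) (p : 'rV[R]_n) (U : 'M[R]_(d, n)) :
  row_free U -> S p -> (forall i, S (p + row i U)) ->
  (forall x, S x -> (x - p <= U)%MS) -> has_dim S d.
Proof.
move=> fU Sp SU hS; split; first by exists p.
exists U; split=> // W; split=> [UW x y Sx Sy|h].
  have -> : x - y = (x - p) - (y - p) by rewrite opprB addrA subrK.
  rewrite addmx_sub ?eqmx_opp //; first exact: submx_trans (hS _ Sx) UW.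
  exact: submx_trans (hS _ Sy) UW.
by apply/row_subP => i; have := h _ _ (SU i) Sp; rewrite addrC addKr.
Qed.

Lemma has_dim_uniq (R : realType) n (S : set 'rV[R]_n) d e :
  has_dim S d -> has_dim S e -> d = e.
Proof.
move=> [_ [U [fU hU]]] [_ [V [fV hV]]].
have UV : (U <= V)%MS by rewrite -(genmxE V); apply/hU/hV; rewrite genmxE.
have VU : (V <= U)%MS by rewrite -(genmxE U); apply/hV/hU; rewrite genmxE.
by rewrite -(eqP fU) -(eqP fV); apply/eqP; rewrite eqn_leq !mxrankS.
Qed.

Lemma of_intD (R : realType) m n (A B : 'M[int]_(m, n)) :
  of_int R (A + B) = of_int R A + of_int R B.
Proof. exact: map_mxD. Qed.

Lemma of_intN (R : realType) m n (A : 'M[int]_(m, n)) : of_int R (- A) = - of_int R A.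
Proof. exact: map_mxN. Qed.

Lemma of_intB (R : realType) m n (A B : 'M[int]_(m, n)) :
  of_int R (A - B) = of_int R A - of_int R B.
Proof. exact: map_mxB. Qed.

Lemma of_intZ (R : realType) m n a (A : 'M[int]_(m, n)) : of_int R (a *: A) = a%:~R *: of_int R A.
Proof. exact: map_mxZ. Qed.

Lemma of_intM (R : realType) m n p (A : 'M[int]_(m, n)) (B : 'M[int]_(n, p)) :
  of_int R (A *m B) = of_int R A *m of_int R B.
Proof. exact: map_mxM. Qed.

Lemma of_int_row (R : realType) m n i (A : 'M[int]_(m, n)) :
  of_int R (row i A) = row i (of_int R A).
Proof. exact: map_row. Qed.

Lemma of_int_inj (R : realType) m n : injective (@of_int R m n).
Proof.
move=> A B /matrixP AB; apply/matrixP => i j.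
by apply/eqP; rewrite -(eqr_int R); have := AB i j; rewrite !mxE => ->.
Qed.

Lemma primitive_part n (z : 'rV[int]_n) : z != 0 ->
  exists (g : nat) (p : 'rV[int]_n), [/\ (0 < g)%N, primitive p & z = g%:Z *: p].
Proof.
move=> z0; pose g := \big[gcdn/0%N]_(i < n) absz (z 0 i).
have gz i : (g %| `|z 0%R i|)%N by apply: (@biggcdn_inf _ i).
have g0 : (0 < g)%N.
  rewrite lt0n; apply: contraNneq z0 => g0; apply/eqP/rowP => i; rewrite mxE.
  by have := gz i; rewrite g0 dvd0n absz_eq0 => /eqP.
pose p : 'rV[int]_n := \row_i divz (z 0 i) g%:Z.
have zE : z = g%:Z *: p.
  by apply/rowP => i; rewrite !mxE mulrC divzK ?dvdzE ?gz.
exists g, p; split=> //; rewrite /primitive.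
set h := \big[gcdn/0%N]_(i < n) _.
have : (g * h %| g * 1)%N.
  rewrite muln1; apply/dvdn_biggcdP => i _.
  by rewrite zE mxE abszM dvdn_mul //; apply: (@biggcdn_inf _ i).
by rewrite dvdn_pmul2l // dvdn1 => /eqP.
Qed.

(** The directions from [v] to the other points of the polytope, scaled to lie on a
    hyperplane that separates [v] from these points, span a polytope; the line from [v]
    through one of its vertices cuts the polytope in an edge.  A functional that
    decreases somewhere is negative at a vertex of that cross-section. *)
Lemma edge_vector_decreasing (R : realType) n (P : set 'rV[R]_n) v f x :
  lattice_polytope P -> vertex P v -> P x -> dot f x < dot f v ->
  exists2 w, edge_vector P v w & dot f (of_int R w) < 0.
Proof.
move=> [pP latP] vv Px fx.
have [m [A PA]] := pP.
have PrA i : P (row i A) by rewrite PA; exact: hull_row.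
have [_ [c0 [b [cb vE]]]] := vv.
have [Pv cv] : P v /\ dot c0 v = b by have : [set v] v by []; rewrite vE.
pose tau i := b - dot c0 (row i A).
have tau0 i : 0 <= tau i by rewrite subr_ge0 cb.
have tauv i : tau i = 0 -> row i A = v.
  move=> /eqP; rewrite subr_eq0 => /eqP h.
  by have : (P `&` [set y | dot c0 y = b]) (row i A) by []; rewrite -vE.
have [i0 fi0] : exists i0, dot f (row i0 A) < dot f v.
  apply: contrapT => /forallNP h.
  have : dot (- f) x <= dot (- f) v.
    move: Px; rewrite PA; apply: hull_le => i; rewrite !dotNl lerN2 leNgt.
    by apply/negP/h.
  by rewrite !dotNl lerN2 leNgt fx.
have ti0 : tau i0 != 0 by apply: contraTneq fi0 => /tauv ->; rewrite ltxx.
pose D := \matrix_i (let k := if tau i == 0 then i0 else i in (tau k)^-1 *: (row k A - v)).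
have rD i : row i D = let k := if tau i == 0 then i0 else i in (tau k)^-1 *: (row k A - v).
  by rewrite rowK.
have AD i : row i A - v = tau i *: row i D.
  rewrite rD /=; case: eqVneq => [t0|t0]; first by rewrite t0 scale0r tauv // subrr.
  by rewrite scalerA divff // scale1r.
have c0Av i : dot c0 (row i A - v) = - tau i by rewrite dotBr cv opprB.
have pQ : polytope (hull D) by exists m, D.
have Q0 : hull D !=set0 by exists (row i0 D); exact: hull_row.
have [d vd [Qd fd]] := argmax_vertex (- f) pQ Q0.
have fd0 : dot f d < 0.
  have := fd _ (hull_row D i0); rewrite !dotNl lerN2 => h; apply: le_lt_trans h _.
  rewrite rD /= (negPf ti0) dotZr pmulr_rlt0 ?dotBr ?subr_lt0 // invr_gt0.
  by rewrite lt_def ti0 tau0.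
have [_ [g [be [gbe dE]]]] := vd.
have gd : dot g d = be by have : [set d] d by []; rewrite dE => -[].
have gD i : dot g (row i D) <= be by apply: gbe; exact: hull_row.
have Dd i : dot g (row i D) = be -> row i D = d.
  move=> h; have : (hull D `&` [set y | dot g y = be]) (row i D).
    by split=> //; exact: hull_row.
  by rewrite -dE.
pose h := g + be *: c0.
have hA i : dot h (row i A) - dot h v = tau i * (dot g (row i D) - be).
  rewrite -dotBr /h dotDl dotZl c0Av AD dotZr; ring.
have hA0 i : dot h (row i A) <= dot h v.
  by rewrite -subr_le0 hA mulr_ge0_le0 // subr_le0.
pose E := P `&` [set y | dot h y = dot h v].
have Ev : E v by [].
have fE : face P E.
  split; first by exists v.
  by exists h, (dot h v); split=> // y; rewrite PA; apply: hull_le.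
have Eray y : E y -> y - v = (b - dot c0 y) *: d.
  move=> [+ /= hy]; rewrite PA => -[l [l0 l1] ly].
  have := hull_tight hA0 l0 l1; rewrite ly => /(_ hy) tight.
  have e1 : y - v = (\sum_i l 0 i * tau i) *: d.
    rewrite -ly mulmx_sum_row -[v in LHS]scale1r -l1 !scaler_suml -sumrB.
    apply: eq_bigr => i _; rewrite -scalerBr AD scalerA.
    have [->|li] := eqVneq (l 0 i) 0; first by rewrite mul0r !scale0r.
    have [->|ti] := eqVneq (tau i) 0; first by rewrite mulr0 !scale0r.
    have /eqP := hA i; rewrite tight // subrr eq_sym mulf_eq0 (negPf ti) subr_eq0 /=.
    by move=> /eqP/Dd ->.
  rewrite e1; congr (_ *: _).
  rewrite -ly dot_mulmx -[b]mul1r -l1 mulr_suml -sumrB.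
  by apply: eq_bigr => i _; rewrite /tau mulrBr.
have [k tk kd] : exists2 k, tau k != 0 & row k D = d.
  have [l [l0 l1] ld] := Qd.
  have [i li] := sum1_neq0 l1.
  have := hull_tight gD l0 l1; rewrite ld => /(_ gd i li)/Dd di.
  have [ti|ti] := eqVneq (tau i) 0; last by exists i.
  by exists i0 => //; rewrite -di !rD /= ti eqxx (negPf ti0).
have Ek : E (row k A).
  by split=> //=; apply/eqP; rewrite -subr_eq0 hA kd gd subrr mulr0.
have [w vw [Ew cw]] := argmax_vertex (- c0) (face_polytope pP fE) (ex_intro _ v Ev).
have wP := face_trans pP fE vw.
pose t := b - dot c0 w.
have t0 : 0 < t.
  have := cw _ Ek; rewrite !dotNl lerN2 => ck.
  have : 0 < tau k by rewrite lt_def tk tau0.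
  rewrite /tau /t; lra.
have wv : w - v = t *: d by apply: Eray.
have [wz wzE] := latP _ wP; have [vz vzE] := latP _ vv.
have ftd : dot f (w - v) < 0 by rewrite wv dotZr pmulr_rlt0.
have z0 : wz - vz != 0.
  apply: contraTneq ftd => z0.
  by rewrite wzE vzE -of_intB z0 dotE /of_int map_mx0 mul0mx mxE ltxx.
have [gz [p [g0 pp zE]]] := primitive_part z0.
have wvp : w - v = gz%:R *: of_int R p by rewrite wzE vzE -of_intB zE of_intZ.
have gz0 : 0 < gz%:R :> R by rewrite ltr0n.
exists p; last by move: ftd; rewrite wvp dotZr pmulr_rlt0.
split=> //; exists E; last by exists gz%:R => //; rewrite -wvp addrC subrK.
split=> //; split=> //.
apply: (@has_dim_basis _ _ _ _ v (t *: d)) => //.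
- rewrite /row_free rank_rV -wv; apply/eqP; case: eqVneq => // h0.
  by move: ftd; rewrite h0 dotE mul0mx mxE ltxx.
- by move=> i; rewrite -wv row_id addrC subrK.
- move=> y Ey; rewrite (Eray _ Ey).
  have -> : (b - dot c0 y) *: d = ((b - dot c0 y) / t) *: (t *: d).
    by rewrite scalerA divfK // gt_eqF.
  exact: scalemx_sub.
Qed.

(** * Unimodular charts *)

Definition pt (R : realType) n (p : 'rV[R]_n) (U : 'M[int]_n) (y : 'rV[R]_n) : 'rV[R]_n :=
  p + y *m of_int R U.

Definition coord (R : realType) n (p : 'rV[R]_n) (W : 'M[int]_n) (x : 'rV[R]_n) : 'rV[R]_n :=
  (x - p) *m of_int R W.

(** In coordinates at [p] the set [Q] lies in the orthant of the variables outside [J].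
    Charts of a polytope have empty [J]; a face and its first displacement share the basis
    and [J], and differ in the base point. *)
Record chart (R : realType) n (Q : set 'rV[R]_n) (p : 'rV[R]_n) (U W : 'M[int]_n)
    (J : {set 'I_n}) : Prop := Chart {
  chart_inv : U *m W = 1%:M;
  chart_base : Q p;
  chart_ge0 : forall x j, Q x -> 0 <= coord p W x 0 j;
  chart_eq0 : forall x j, Q x -> j \in J -> coord p W x 0 j = 0
}.

Definition unit_steps (R : realType) n (Q : set 'rV[R]_n) (p : 'rV[R]_n) (U : 'M[int]_n)
    (J : {set 'I_n}) : Prop :=
  forall j, j \notin J -> Q (p + row j (of_int R U)).

Lemma of_int1 (R : realType) n : of_int R (1%:M : 'M_n) = 1%:M.
Proof. exact: map_mx1. Qed.

Lemma coord_pt (R : realType) n (p : 'rV[R]_n) U W y : U *m W = 1%:M -> coord p W (pt p U y) = y.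
Proof. by move=> UW; rewrite /coord /pt addrC addKr -mulmxA -of_intM UW of_int1 mulmx1. Qed.

Lemma pt_coord (R : realType) n (p : 'rV[R]_n) U W x : U *m W = 1%:M -> pt p U (coord p W x) = x.
Proof.
move=> /mulmx1C WU; rewrite /coord /pt -mulmxA -of_intM WU of_int1 mulmx1.
by rewrite addrC subrK.
Qed.

Lemma pt_delta (R : realType) n (p : 'rV[R]_n) U j : pt p U (delta_mx 0 j) = p + row j (of_int R U).
Proof. by rewrite /pt -rowE. Qed.

Lemma pt0 (R : realType) n (p : 'rV[R]_n) U : pt p U 0 = p.
Proof. by rewrite /pt mul0mx addr0. Qed.

Lemma coord_base (R : realType) n (p : 'rV[R]_n) W j : coord p W p 0 j = 0.
Proof. by rewrite /coord subrr mul0mx mxE. Qed.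

Lemma coord_step (R : realType) n (p : 'rV[R]_n) U W i j : U *m W = 1%:M ->
  coord p W (p + row i (of_int R U)) 0 j = (i == j)%:R.
Proof. by move=> UW; rewrite -pt_delta coord_pt // mxE eqxx eq_sym. Qed.

Lemma dot_pt (R : realType) n (p : 'rV[R]_n) U c y :
  dot c (pt p U y) = dot c p + \sum_j y 0 j * dot c (row j (of_int R U)).
Proof. by rewrite dotDr dot_mulmx. Qed.

Lemma dot_coord (R : realType) n (p : 'rV[R]_n) U W c x : U *m W = 1%:M ->
  dot c x = dot c p + \sum_j coord p W x 0 j * dot c (row j (of_int R U)).
Proof. by move=> UW; rewrite -dot_pt pt_coord. Qed.

Lemma convex_pt (R : realType) n (p : 'rV[R]_n) U y z t :
  pt p U ((1 - t) *: y + t *: z) = (1 - t) *: pt p U y + t *: pt p U z.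
Proof.
rewrite /pt mulmxDl -!scalemxAl !scalerDr addrACA -scalerDl subrK scale1r //.
Qed.

(** When [W] inverts [U], this is the functional with values [w] on the rows of [U]. *)
Definition dual (R : realType) n (W : 'M[int]_n) (w : 'rV[R]_n) : 'rV[R]_n :=
  w *m (of_int R W)^T.

Lemma dot_dual (R : realType) n (U W : 'M[int]_n) (w : 'rV[R]_n) j : U *m W = 1%:M ->
  dot (dual W w) (row j (of_int R U)) = w 0 j.
Proof.
move=> UW; rewrite dotE /dual trmx_mul trmxK mulmxA -row_mul -of_intM UW of_int1.
by rewrite -row_mul mul1mx !mxE.
Qed.

Lemma chart_dim (R : realType) n (Q : set 'rV[R]_n) p U W J :
  chart Q p U W J -> unit_steps Q p U J -> has_dim Q #|~: J|.
Proof.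
move=> [UW Qp _ Q0] Qs.
pose f (i : 'I_#|~: J|) : 'I_n := enum_val i.
have fJ i : f i \notin J by have := enum_valP i; rewrite inE.
apply: (@has_dim_basis _ _ _ _ p (\matrix_i row (f i) (of_int R U))) => //.
- apply/row_freeP; exists (\matrix_(i, j) of_int R W i (f j)).
  apply/matrixP => i j; rewrite !mxE.
  under eq_bigr do rewrite !mxE.
  have := congr1 (fun A : 'M[R]_n => A (f i) (f j)) (of_int1 R n).
  rewrite -UW of_intM mxE [RHS]mxE (inj_eq enum_val_inj) => <-.
  by apply: eq_bigr => k _; rewrite !mxE.
- by move=> i; rewrite rowK; apply: Qs.
- move=> x Qx; rewrite -{1}(pt_coord p x UW) /pt addrC addKr mulmx_sum_row.
  apply: summx_sub => j _; have [jJ|jJ] := boolP (j \in J).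
    by rewrite Q0 // scale0r sub0mx.
  have jC : j \in ~: J by rewrite inE.
  apply: scalemx_sub; rewrite -[j](enum_rankK_in jC) //.
  by rewrite -(rowK (fun i => row (f i) (of_int R U))) row_sub.
Qed.

(** The terms of the expansion of [c] in the coordinates are nonpositive, so a maximal point
    makes each of them vanish. *)
Lemma argmax_chart (R : realType) n (Q : set 'rV[R]_n) p U W J c :
  chart Q p U W J -> (forall j, j \notin J -> dot c (row j (of_int R U)) <= 0) ->
  argmax Q c = Q `&` [set x | forall j, j \notin J -> dot c (row j (of_int R U)) < 0 ->
                              coord p W x 0 j = 0].
Proof.
move=> [UW Qp Q0 QJ] cU.
have le0 x j : Q x -> coord p W x 0 j * dot c (row j (of_int R U)) <= 0.
  move=> Qx; have [jJ|jJ] := boolP (j \in J); first by rewrite QJ ?mul0r.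
  by rewrite mulr_ge0_le0 ?Q0 ?cU.
apply/seteqP; split=> x /= [Qx hx]; split=> //.
- move=> j jJ cj; have := hx _ Qp; rewrite (dot_coord p c x UW) lerDl => h.
  have /eqP : \sum_j coord p W x 0 j * dot c (row j (of_int R U)) = 0.
    by apply/eqP; rewrite eq_le h andbT sumr_le0 // => i _; apply: le0.
  rewrite -oppr_eq0 -sumrN psumr_eq0 => [/allP|i _]; last by rewrite oppr_ge0 le0.
  move=> /(_ j (mem_index_enum j)); rewrite oppr_eq0 mulf_eq0 (lt_eqF cj) orbF.
  by move=> /eqP.
- move=> z Qz; rewrite (dot_coord p c x UW) (dot_coord p c z UW) lerD2l.
  apply: ler_sum => j _; have [jJ|jJ] := boolP (j \in J); first by rewrite !QJ.
  have := cU _ jJ; rewrite le_eqVlt => /orP[/eqP ->|cj]; first by rewrite !mulr0.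
  by rewrite hx // mul0r le0.
Qed.

Lemma chart_argmax (R : realType) n (Q : set 'rV[R]_n) p U W J c :
  chart Q p U W J -> (forall j, j \notin J -> dot c (row j (of_int R U)) <= 0) ->
  chart (argmax Q c) p U W (J :|: [set j | dot c (row j (of_int R U)) < 0]).
Proof.
move=> ch cU; rewrite (argmax_chart ch cU); case: ch => UW Qp Q0 QJ.
split=> //=.
- by split=> // j _ _; rewrite coord_base.
- by move=> x j [Qx _]; apply: Q0.
- move=> x j [Qx hx]; rewrite !inE; have [jJ|jJ] := boolP (j \in J) => /= h.
    by rewrite QJ.
  by rewrite hx.
Qed.

Lemma unit_steps_argmax (R : realType) n (Q : set 'rV[R]_n) p U W J c :
  chart Q p U W J -> unit_steps Q p U J ->
  (forall j, j \notin J -> dot c (row j (of_int R U)) <= 0) ->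
  unit_steps (argmax Q c) p U (J :|: [set j | dot c (row j (of_int R U)) < 0]).
Proof.
move=> ch Qs cU j; rewrite !inE negb_or => /andP[jJ cj].
rewrite (argmax_chart ch cU); split; first exact: Qs.
move=> i iJ ci; rewrite coord_step ?(chart_inv ch) //.
by case: eqVneq ci cj => // -> ->.
Qed.

(** The local description of the normal fan: only the signs of a functional on the basis
    vectors matter, and the set itself does not enter. *)
Lemma normal_cone_chart (R : realType) n (Q : set 'rV[R]_n) p U W J c :
  chart Q p U W J -> unit_steps Q p U J ->
  (forall j, j \notin J -> dot c (row j (of_int R U)) <= 0) ->
  normal_cone Q (argmax Q c)
    = [set d | forall j, j \notin J -> dot d (row j (of_int R U)) <= 0
                 /\ (dot c (row j (of_int R U)) = 0 -> dot d (row j (of_int R U)) = 0)].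
Proof.
move=> ch Qs cU; have [UW Qp Q0 QJ] := ch.
have ch' := chart_argmax ch cU; have Qs' := unit_steps_argmax ch Qs cU.
apply/seteqP; split=> d /= hd.
- move=> j jJ; have := hd _ _ (chart_base ch') (Qs _ jJ).
  rewrite dotDr gerDl => dj; split=> // cj.
  apply/eqP; rewrite eq_le dj.
  have /Qs' Aj : j \notin J :|: [set j | dot c (row j (of_int R U)) < 0].
    by rewrite !inE negb_or jJ cj ltxx.
  by have := hd _ _ Aj Qp; rewrite dotDr lerDl.
- move=> x z; rewrite (argmax_chart ch cU) => -[Qx hx] Qz.
  rewrite (dot_coord p d x UW) (dot_coord p d z UW) lerD2l; apply: ler_sum => j _.
  have [jJ|jJ] := boolP (j \in J); first by rewrite !QJ.
  have [dj d0] := hd _ jJ; have := cU _ jJ.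
  rewrite le_eqVlt => /orP[/eqP cj|cj]; first by rewrite d0 // !mulr0.
  by rewrite hx // mul0r mulr_ge0_le0 ?Q0.
Qed.

(** * Coordinate slices, facets and first displacements *)

Definition ind (R : realType) n (J : {set 'I_n}) : 'rV[R]_n := \row_j (j \in J)%:R.

(** At [t = 0] these are the faces through [p], at [t = 1] their first displacements. *)
Definition slice (R : realType) n (P : set 'rV[R]_n) p W (J : {set 'I_n}) (t : R) :
    set 'rV[R]_n :=
  P `&` [set x | forall j, j \in J -> coord p W x 0 j = t].

Lemma dot_dual_ind (R : realType) n (U W : 'M[int]_n) (J : {set 'I_n}) j : U *m W = 1%:M ->
  dot (dual W (- ind R J)) (row j (of_int R U)) = - (j \in J)%:R.
Proof. by move=> UW; rewrite dot_dual // !mxE. Qed.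

Lemma slice_argmax (R : realType) n (P : set 'rV[R]_n) p U W J : chart P p U W finset.set0 ->
  slice P p W J 0 = argmax P (dual W (- ind R J)).
Proof.
move=> ch; have UW := chart_inv ch.
rewrite (argmax_chart ch) => [|j _]; last first.
  by rewrite dot_dual_ind // oppr_le0 ler0n.
apply/seteqP; split=> x /= [Px hx]; split=> // j.
- by move=> _; rewrite dot_dual_ind // oppr_lt0 ltr0n lt0b; apply: hx.
- by move=> jJ; apply: hx; rewrite ?inE // dot_dual_ind // jJ oppr_lt0 ltr01.
Qed.

Lemma chart_slice (R : realType) n (P : set 'rV[R]_n) p U W J : chart P p U W finset.set0 ->
  chart (slice P p W J 0) p U W J.
Proof.
move=> [UW Pp P0 _]; split=> //.
- by split=> // j _; rewrite coord_base.
- by move=> x j [Px _]; apply: P0.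
- by move=> x j [_ hx]; apply: hx.
Qed.

Lemma unit_steps_slice (R : realType) n (P : set 'rV[R]_n) p U W J : chart P p U W finset.set0 ->
  unit_steps P p U finset.set0 -> unit_steps (slice P p W J 0) p U J.
Proof.
move=> ch Ps j jJ; split=> [|i iJ]; first by apply: Ps; rewrite inE.
rewrite coord_step ?(chart_inv ch) //.
by case: eqVneq jJ => // ->; rewrite iJ.
Qed.

Lemma slice_face (R : realType) n (P : set 'rV[R]_n) p U W J : chart P p U W finset.set0 ->
  face P (slice P p W J 0).
Proof.
move=> ch; apply/faceP; split; first by exists p; apply: chart_base (chart_slice J ch).
by exists (dual W (- ind R J)); apply: slice_argmax ch.
Qed.

Lemma slice_codim (R : realType) n (P : set 'rV[R]_n) p U W J : chart P p U W finset.set0 ->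
  unit_steps P p U finset.set0 -> has_codim (slice P p W J 0) #|J|.
Proof.
move=> ch Ps; exists #|~: J|; first by rewrite addnC finset.cardsC card_ord.
exact: chart_dim (chart_slice J ch) (unit_steps_slice ch Ps).
Qed.

Lemma primitive_inv n (u : 'rV[int]_n) (z : 'cV[int]_n) : u *m z = 1%:M -> primitive u.
Proof.
move=> /matrixP /(_ 0 0); rewrite !mxE eqxx => uz.
set g := \big[gcdn/0%N]_(i < n) `|u 0%R i|%N; apply/eqP; rewrite -dvdn1.
have : (g%:Z %| (\sum_j u 0%R j * z j 0%R)%R)%Z.
  apply: rpred_sum => i _; apply: dvdz_mulr; rewrite dvdzE /=.
  exact: (@biggcdn_inf _ i).
by rewrite uz dvdzE.
Qed.

Lemma dot_col (R : realType) n (W : 'M[int]_n) j (x : 'rV[R]_n) :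
  dot (of_int R (- (col j W)^T)) x = - (x *m of_int R W) 0 j.
Proof.
rewrite of_intN dotNl /dot mxE; congr (- _).
by apply: eq_bigr => i _; rewrite !mxE mulrC.
Qed.

Lemma facet_slack (R : realType) n (p : 'rV[R]_n) W j x :
  dot (of_int R (- (col j W)^T)) p - dot (of_int R (- (col j W)^T)) x = coord p W x 0 j.
Proof. by rewrite -dotBr dot_col /coord -[x - p]opprB mulNmx [RHS]mxE. Qed.

Lemma slice_facet (R : realType) n (P : set 'rV[R]_n) p U W j : chart P p U W finset.set0 ->
  unit_steps P p U finset.set0 ->
  facet_ineq P (slice P p W [set j] 0) (- (col j W)^T)
             (dot (of_int R (- (col j W)^T)) p).
Proof.
move=> ch Ps; have UW := chart_inv ch.
split.
- split; first exact: slice_face ch.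
  by rewrite -[1%N](cards1 j); apply: slice_codim ch Ps.
- apply: (@primitive_inv _ _ (- (row j U)^T)); rewrite mulNmx mulmxN opprK.
  rewrite -trmx_mul -[RHS]trmx1; congr (_^T); apply/matrixP => a b.
  have := congr1 (fun A : 'M_n => A j j) UW; rewrite !mxE !ord1 eqxx => <-.
  by apply: eq_bigr => i _; rewrite !mxE.
- by move=> x Px; rewrite -subr_ge0 facet_slack (chart_ge0 ch).
- apply/seteqP; split=> x /= [Px hx]; split=> //.
    by apply/eqP; rewrite eq_sym -subr_eq0 facet_slack hx ?inE.
  by move=> i; rewrite inE => /eqP ->; rewrite -facet_slack hx subrr.
Qed.

(** A facet through the base point has a single negative slope along the basis vectors,
    because each negative slope costs one dimension; primitivity makes it [-1]. *)
Lemma facet_coord (R : realType) n (P : set 'rV[R]_n) p U W G u b : chart P p U W finset.set0 ->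
  unit_steps P p U finset.set0 -> facet_ineq P G u b -> G p ->
  exists l, forall x, b - dot (of_int R u) x = coord p W x 0 l.
Proof.
move=> ch Ps [[fG [d dn hd]] pu ub GE] Gp; have UW := chart_inv ch.
have up : dot (of_int R u) p = b by move: Gp; rewrite GE => -[].
have GA : G = argmax P (of_int R u).
  rewrite GE; apply/seteqP; split=> x /= [Px hx]; split=> //.
    by move=> z Pz; rewrite hx ub.
  by apply/eqP; rewrite eq_le ub //= -up hx //; apply: chart_base ch.
have cU j : j \notin (finset.set0 : {set 'I_n}) -> dot (of_int R u) (row j (of_int R U)) <= 0.
  by move=> /Ps Pj; have := ub _ Pj; rewrite dotDr up gerDl.
have dG := chart_dim (chart_argmax ch cU) (unit_steps_argmax ch Ps cU).
rewrite -GA finset.set0U in dG.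
pose m := u *m U^T.
have mE j : dot (of_int R u) (row j (of_int R U)) = (m 0 j)%:~R.
  rewrite /m mxE rmorph_sum; apply: eq_bigr => i _.
  by rewrite !mxE rmorphM.
pose N : {set 'I_n} := [set j | dot (of_int R u) (row j (of_int R U)) < 0]%SET.
have NE j : (j \in N) = (dot (of_int R u) (row j (of_int R U)) < 0) by rewrite inE.
have [l lE] : exists l, N = [set l]%SET.
  apply/cards1P/eqP; have := has_dim_uniq dG hd; have := finset.cardsC N.
  by rewrite card_ord -/N; move: #|N| #|~: N| dn => a a' dn h1 h2; lia.
have m0 j : j != l -> m 0 j = 0.
  move=> jl; apply/eqP; rewrite -(intr_eq0 R) -mE eq_le cU ?inE //= leNgt.
  by rewrite -NE lE inE.
have ml0 : (m 0 l < 0) by rewrite -(ltrz0 R) -mE -NE lE inE.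
have uE i : u 0 i = m 0 l * W i l.
  have -> : u = m *m W^T by rewrite -mulmxA -trmx_mul (mulmx1C UW) trmx1 mulmx1.
  by rewrite mxE (bigD1 l) //= big1 => [|k /m0 ->]; rewrite ?mul0r // addr0 [W^T _ _]mxE.
have ml1 : m 0 l = -1.
  have : (`|m 0%R l| %| 1)%N.
    by rewrite -[X in (_ %| X)%N]pu; apply/dvdn_biggcdP => i _; rewrite uE abszM dvdn_mulr.
  rewrite dvdn1 => /eqP; lia.
exists l => x; rewrite (dot_coord p _ x UW) up (bigD1 l) //= big1 => [|j /m0 mj].
  by rewrite mE ml1; ring.
by rewrite mE mj mulr0.
Qed.

Lemma slice_displacement (R : realType) n (P : set 'rV[R]_n) p U W J : chart P p U W finset.set0 ->
  unit_steps P p U finset.set0 -> first_displacement P (slice P p W J 0) (slice P p W J 1).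
Proof.
move=> ch Ps; have UW := chart_inv ch.
exists #|J|, (fun i => slice P p W [set enum_val i] 0), (fun i => - (col (enum_val i) W)^T),
  (fun i => dot (of_int R (- (col (enum_val i) W)^T)) p).
split.
- exact: slice_codim ch Ps.
- move=> i k /= ik; apply/enum_val_inj/eqP/negPn/negP => nik.
  have : slice P p W [set enum_val i] 0 (p + row (enum_val k) (of_int R U)).
    split; first by apply: Ps; rewrite inE.
    by move=> j; rewrite inE => /eqP ->; rewrite coord_step // eq_sym (negPf nik).
  rewrite ik => -[_ /(_ (enum_val k))]; rewrite inE eqxx coord_step // eqxx => /(_ isT) /eqP.
  by rewrite oner_eq0.
- by move=> i; apply: slice_facet ch Ps.
- apply/seteqP; split=> x [Px hx]; split=> //.
    by move=> i; split=> // j; rewrite inE => /eqP ->; apply: hx; apply: enum_valP.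
  move=> j jJ; have [_] := hx (enum_rank_in jJ j); apply.
  by rewrite enum_rankK_in // inE.
- have E i x : (dot (of_int R (- (col i W)^T)) x = dot (of_int R (- (col i W)^T)) p - 1)
      <-> coord p W x 0 i = 1.
    by rewrite -facet_slack; split=> h; lra.
  apply/seteqP; split=> x [Px hx]; split=> //.
    by move=> i; apply/E/hx/enum_valP.
  move=> j jJ; have /E := hx (enum_rank_in jJ j).
  by rewrite enum_rankK_in.
Qed.

Lemma displacement_slice (R : realType) n (P : set 'rV[R]_n) p U W F D :
  chart P p U W finset.set0 ->
  unit_steps P p U finset.set0 -> first_displacement P F D -> F p ->
  exists J, F = slice P p W J 0 /\ D = slice P p W J 1.
Proof.
move=> ch Ps [k [G [u [b [_ _ Gf FE DE]]]]] Fp.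
have Gp i : G i p by move: Fp; rewrite FE => -[_]; apply.
have /(@choice _ _ _) [f fE] : forall i, exists l, forall x,
    b i - dot (of_int R (u i)) x = coord p W x 0 l.
  by move=> i; apply: facet_coord ch Ps (Gf i) (Gp i).
exists [set f i | i : 'I_k]; split.
- rewrite FE; apply/seteqP; split=> x [Px hx]; split=> //.
    move=> _ /imsetP[i _ ->]; rewrite -fE; have [_ _ _ GE] := Gf i.
    by have := hx i; rewrite GE => -[_ /= ->]; rewrite subrr.
  move=> i; have [_ _ _ ->] := Gf i; split=> //=.
  by apply/eqP; rewrite eq_sym -subr_eq0 fE hx ?imset_f.
- rewrite DE; apply/seteqP; split=> x [Px hx]; split=> //.
    by move=> _ /imsetP[i _ ->]; rewrite -fE hx; ring.
  by move=> i; have := hx (f i) (imset_f f isT); rewrite -fE => h; lra.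
Qed.

(** * Charts at the vertices of a smooth lattice polytope *)

Lemma vertex_mem (R : realType) n (P : set 'rV[R]_n) v : vertex P v -> P v.
Proof. by move=> [_ [c [b [_ vE]]]]; have : [set v] v by []; rewrite vE => -[]. Qed.

Lemma coord_int (R : realType) n (p q : 'rV[int]_n) W j :
  coord (of_int R p) W (of_int R q) 0 j = (((q - p) *m W) 0 j)%:~R.
Proof. by rewrite /coord -of_intB -of_intM [LHS]mxE. Qed.

Lemma dot_dual_delta (R : realType) n (p : 'rV[R]_n) U W j x : U *m W = 1%:M ->
  dot (dual W (delta_mx 0 j)) x = dot (dual W (delta_mx 0 j)) p + coord p W x 0 j.
Proof.
move=> UW; rewrite (dot_coord p _ x UW) (bigD1 j) //= big1 ?addr0 => [|i ij].
  by rewrite dot_dual // [delta_mx _ _ _ _]mxE !eqxx mulr1.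
by rewrite dot_dual // [delta_mx _ _ _ _]mxE (negPf ij) mulr0.
Qed.

(** The far end of the edge along the [j]-th basis vector is a vertex, hence a lattice point,
    so its [j]-th coordinate is a positive integer. *)
Lemma edge_end (R : realType) n (P : set 'rV[R]_n) p U W j t :
  lattice_polytope P -> vertex P p -> chart P p U W finset.set0 ->
  0 < t -> P (p + t *: row j (of_int R U)) ->
  exists s : nat, (0 < s)%N /\ vertex P (p + s%:R *: row j (of_int R U)).
Proof.
move=> [pP latP] vp ch t0 Pt; have UW := chart_inv ch.
pose F := slice P p W (~: [set j]) 0.
have fF : face P F by apply: slice_face ch.
have Fp : F p by apply: chart_base (chart_slice _ ch).
have E x : F x -> x = p + coord p W x 0 j *: row j (of_int R U).
  move=> [Px hx]; rewrite -{1}(pt_coord p x UW) /pt mulmx_sum_row (bigD1 j) //=.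
  by rewrite big1 ?addr0 // => i ij; rewrite hx ?scale0r // !inE.
have cE i r : coord p W (p + r *: row j (of_int R U)) 0 i = r * (j == i)%:R.
  have -> : p + r *: row j (of_int R U) = pt p U (r *: delta_mx 0 j).
    by rewrite /pt -scalemxAl -rowE.
  by rewrite coord_pt // !mxE eqxx eq_sym.
have Ft : F (p + t *: row j (of_int R U)).
  by split=> // i; rewrite !inE cE eq_sym => /negPf ->; rewrite mulr0.
have [w vw [Fw hw]] :=
  argmax_vertex (dual W (delta_mx 0 j)) (face_polytope pP fF) (ex_intro _ p Fp).
have wP := face_trans pP fF vw.
have wt : t <= coord p W w 0 j.
  have := hw _ Ft; rewrite (dot_dual_delta p j w UW) (dot_dual_delta p j (_ + _) UW) lerD2l.
  by rewrite cE eqxx mulr1.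
have [pz pzE] := latP _ vp; have [wz wzE] := latP _ wP.
have cw : coord p W w 0 j = (((wz - pz) *m W) 0 j)%:~R by rewrite pzE wzE coord_int.
set z := (_ *m W) 0 j in cw.
have z0 : 0 < z by rewrite -(ltr0z R) -cw (lt_le_trans t0).
exists `|z|%N; split; first by rewrite absz_gt0 gt_eqF.
rewrite (_ : `|z|%:R = coord p W w 0 j) -?E //.
by rewrite cw -[in RHS](gtz0_abs z0).
Qed.

Lemma chart_perm (R : realType) n (Q : set 'rV[R]_n) p U W (s : 'S_n) :
  chart Q p U W finset.set0 -> chart Q p (row_perm s U) (col_perm s W) finset.set0.
Proof.
move=> [UW Qp Q0 _].
have cE x j : coord p (col_perm s W) x 0 j = coord p W x 0 (s j).
  by rewrite !mxE; apply: eq_bigr => i _; rewrite !mxE.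
split=> // [|x j Qx|x j Qx]; last by rewrite inE.
- apply/matrixP => i j.
  have := congr1 (fun A : 'M_n => A (s i) (s j)) UW; rewrite !mxE (inj_eq perm_inj) => <-.
  by apply: eq_bigr => k _; rewrite !mxE.
- by rewrite cE; apply: Q0.
Qed.

Lemma unit_steps_perm (R : realType) n (Q : set 'rV[R]_n) p U (s : 'S_n) :
  unit_steps Q p U finset.set0 -> unit_steps Q p (row_perm s U) finset.set0.
Proof.
move=> Qs j _; have -> : row j (of_int R (row_perm s U)) = row (s j) (of_int R U).
  by apply/rowP => i; rewrite !mxE.
by apply: Qs; rewrite inE.
Qed.

Lemma edge_frame_perm (R : realType) n (P : set 'rV[R]_n) p U V :
  edge_frame P p U -> edge_frame P p V -> exists s : 'S_n, V = row_perm s U.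
Proof.
move=> [injU hU] [injV hV].
have /(@choice _ _ _) [f fE] : forall i, exists j, row j U = row i V.
  by move=> i; apply/hU/hV; exists i.
have injf : injective f by move=> i j ij; apply: injV; rewrite -!fE ij.
exists (perm injf); apply/row_matrixP => i; rewrite -fE; apply/rowP => j.
by rewrite !mxE permE.
Qed.

Lemma lattice_basis_inv n (U : 'M[int]_n) : lattice_basis setT U -> exists W, U *m W = 1%:M.
Proof.
move=> [_ hU].
have /(@choice _ _ _) [f fE] : forall i, exists c : 'rV_n, c *m U = delta_mx 0 i.
  by move=> i; have [c [cE _]] := hU (delta_mx 0 i) I; exists c.
exists (\matrix_i f i); apply: mulmx1C; apply/row_matrixP => i.
by rewrite row_mul rowK fE row1.
Qed.

(** The coordinate functionals are nonnegative on the edge vectors, hence on the polytope;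
    each edge reaches the first lattice point along it because it ends in one. *)
Lemma chart_exists (R : realType) n (P : set 'rV[R]_n) p U :
  smooth P -> lattice_polytope P -> vertex P p -> edge_frame P p U ->
  exists W, chart P p U W finset.set0 /\ unit_steps P p U finset.set0.
Proof.
move=> [pP _ _ _ smP] latP vp fU.
have [V fV /lattice_basis_inv [V' VV']] := smP _ vp.
have [s UE] := edge_frame_perm fV fU.
pose W := col_perm s V'.
have UW : U *m W = 1%:M.
  apply/matrixP => i j; have := congr1 (fun A : 'M_n => A (s i) (s j)) VV'.
  rewrite UE !mxE (inj_eq perm_inj) => <-.
  by apply: eq_bigr => k _; rewrite !mxE.
have Pp := vertex_mem vp.
have ch : chart P p U W finset.set0.
  split=> // [x j Px|x j _]; last by rewrite inE.
  rewrite leNgt; apply/negP => xj.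
  have [|w ew] := edge_vector_decreasing (f := dual W (delta_mx 0 j)) latP vp Px.
    by rewrite (dot_dual_delta p j x UW) gtrDl.
  have /fU.2 [i <-] := ew.
  by rewrite of_int_row dot_dual // [delta_mx _ _ _ _]mxE ltNge ler0n.
exists W; split=> // j _.
have [_ [E [[fE _] _] [t t0 Et]]] : edge_vector P p (row j U) by apply/fU.2; exists j.
have Pt : P (p + t *: row j (of_int R U)).
  by move: fE => [_ [c [b [_ EE]]]]; move: Et; rewrite EE of_int_row => -[].
have [k [k0 /vertex_mem Pk]] := edge_end latP vp ch t0 Pt.
have k0' : 0 < k%:R :> R by rewrite ltr0n.
have k1 : 0 <= (k%:R : R)^-1 <= 1.
  by rewrite invr_ge0 ltW //= invf_le1 // ler1n.
have := polytope_convex pP k1 Pp Pk.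
by rewrite scalerDr scalerA mulVf ?gt_eqF // scale1r addrA -scalerDl subrK scale1r.
Qed.

Lemma int_unit (a b : int) : a * b = 1 -> a = 1 \/ a = -1.
Proof.
move=> /(congr1 absz); rewrite abszM => /eqP; rewrite muln_eq1 => /andP[/eqP a1 _].
by lia.
Qed.

(** Both end points of an edge lie on the facets containing the edge, so these facets give
    common coordinates; only the coordinate along the edge changes. *)
Lemma chart_neighbor (R : realType) n (P : set 'rV[R]_n) p U W a :
  smooth P -> lattice_polytope P -> vertex P p ->
  chart P p U W finset.set0 -> unit_steps P p U finset.set0 ->
  exists (s : nat) (k : 'rV[int]_n) (W' : 'M[int]_n),
    let q := p + s%:R *: row a (of_int R U) in
    let U' := U + k^T *m row a U in
    [/\ k 0 a = -2, vertex P q, chart P q U' W' finset.set0 & unit_steps P q U' finset.set0].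
Proof.
move=> smP latP vp ch Ps; have UW := chart_inv ch.
have Pa : P (p + 1 *: row a (of_int R U)) by rewrite scale1r; apply: Ps; rewrite inE.
have [s [s0 vq]] := edge_end latP vp ch ltr01 Pa.
set q := p + _ in vq.
have [pP _ _ _ /(_ _ vq) [V fV _]] := smP.
have [V' [ch1 Ps1]] := chart_exists smP latP vq fV.
have cq i : coord p W q 0 i = s%:R * (i == a)%:R.
  have -> : q = pt p U (s%:R *: delta_mx 0 a) by rewrite /pt -scalemxAl -rowE.
  by rewrite coord_pt // !mxE eqxx.
have /(@choice _ _ _) [f fE] : forall i, exists l, i != a ->
    forall x, coord p W x 0 i = coord q V' x 0 l.
  move=> i; have [->|ia] := eqVneq i a; first by exists a.
  have Gq : slice P p W [set i] 0 q.
    split; first exact: vertex_mem vq.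
    by move=> j; rewrite inE => /eqP ->; rewrite cq (negPf ia) mulr0.
  have [l lE] := facet_coord ch1 Ps1 (slice_facet i ch Ps) Gq.
  by exists l => _ x; rewrite -lE facet_slack.
have injf i j : i != a -> j != a -> f i = f j -> i = j.
  move=> ia ja ij; apply/eqP; apply/negPn/negP => nij.
  have := fE i ia (p + row i (of_int R U)); rewrite ij -fE // !coord_step // eqxx.
  by rewrite (negPf nij) => /eqP; rewrite oner_eq0.
(* The index [l0] left over completes the injection [f] to a permutation, by which the edge
   vectors at [q] are reordered like those at [p]. *)
have [l0 hl0] : exists l0, forall i, i != a -> f i != l0.
  have /card_gt0P [l0] : (0 < #|~: (f @: ~: [set a])|)%N.
    rewrite cardsCs finset.setCK card_ord subn_gt0 (leq_ltn_trans (leq_imset_card _ _)) //.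
    by rewrite -[X in (_ < X)%N](card_ord n) -(finset.cardsC [set a]) cards1 add1n.
  rewrite inE => hl0; exists l0 => i ia; apply: contraNneq hl0 => <-.
  by apply: imset_f; rewrite !inE.
pose g i := if i == a then l0 else f i.
have injg : injective g.
  move=> i j; rewrite /g; case: (eqVneq i a) => [->|ia]; case: (eqVneq j a) => [->|ja] //.
  - by move=> /esym/eqP; rewrite (negPf (hl0 _ ja)).
  - by move=> /eqP; rewrite (negPf (hl0 _ ia)).
  - exact: injf.
pose sg := perm injg.
have ch2 := chart_perm sg ch1; have Ps2 := unit_steps_perm sg Ps1.
set U' := row_perm sg V in ch2 Ps2; set W' := col_perm sg V' in ch2.
have UW' := chart_inv ch2.
have cE x i : i != a -> coord p W x 0 i = coord q W' x 0 i.
  move=> ia; rewrite fE // !mxE; apply: eq_bigr => k _.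
  by rewrite !mxE permE /g (negPf ia).
pose M := U' *m W.
have ME l i : i != a -> M l i = (l == i)%:R.
  move=> ia; apply/eqP; rewrite -(eqr_int R).
  have <- : coord p W (q + row l (of_int R U')) 0 i = (M l i)%:~R.
    have -> : coord p W (q + row l (of_int R U')) = coord p W q + of_int R (row l M).
      by rewrite /coord addrAC mulmxDl /M row_mul of_intM of_int_row.
    by rewrite [LHS]mxE cq (negPf ia) mulr0 add0r !mxE.
  by rewrite cE // coord_step // natz.
have MU : M *m U = U' by rewrite -mulmxA (mulmx1C UW) mulmx1.
clearbody M.
have rowaU' : row a U' = M a a *: row a U.
  rewrite -MU row_mul mulmx_sum_row (bigD1 a) //= big1 ?addr0 => [|i ia].
    by rewrite [row a M _ _]mxE.
  by rewrite [row a M _ _]mxE ME // eq_sym (negPf ia) scale0r.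
(* The edge vector at [q] along the edge is primitive and points back to [p]. *)
have Maa : M a a = -1.
  have h1 : M a a = 1 \/ M a a = -1.
    apply: (@int_unit _ ((row a U *m W') 0 a)).
    have := congr1 (fun A : 'M_n => A a a) UW'.
    have -> : (U' *m W') a a = (row a U' *m W') 0 a by rewrite -row_mul [RHS]mxE.
    by rewrite rowaU' -scalemxAl [LHS]mxE => ->; rewrite mxE eqxx.
  have aM : row a U = M a a *: row a U'.
    by rewrite rowaU' scalerA; case: h1 => ->; rewrite ?mulrNN mulr1 scale1r.
  have := chart_ge0 ch2 a (vertex_mem vp).
  have -> : p = pt q U' ((- s%:R * (M a a)%:~R) *: delta_mx 0 a).
    rewrite /pt -scalemxAl -rowE -scalerA -of_int_row -of_intZ -aM /q of_int_row.
    by rewrite scaleNr addrK.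
  rewrite coord_pt // [X in 0 <= X]mxE [X in _ * X]mxE !eqxx mulr1 mulNr oppr_ge0.
  rewrite pmulr_rle0 ?ltr0n // lerz0.
  by case: h1 => ->.
exists s, (\row_l (M l a - (l == a)%:R)), W'; rewrite -/q.
have <- : U' = U + (\row_l (M l a - (l == a)%:R))^T *m row a U.
  rewrite -MU -[X in _ = X + _]mul1mx rowE mulmxA -mulmxDl; congr (_ *m _).
  apply/matrixP => l i; rewrite !mxE big_ord1 !mxE eqxx /=.
  have [->|ia] := eqVneq i a; first by rewrite mulr1 addrC subrK.
  by rewrite ME // mulr0 addr0.
by split=> //; rewrite mxE Maa eqxx.
Qed.

(** * Growing the corner parallelepiped *)

(** In the coordinates at [p], the points of [P] equal to 1 on [S] and to 0 off
    [S], [a], [b] form the unimodular triangle with legs along [a] and [b]. *)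
Definition displaced_triangle (R : realType) n (P : set 'rV[R]_n) p U W (S : {set 'I_n}) a b :
    Prop :=
  [/\ [/\ a != b, a \notin S & b \notin S],
      [/\ P (pt p U (ind R S)), P (pt p U (ind R S + delta_mx 0 a))
        & P (pt p U (ind R S + delta_mx 0 b))]
    & forall x, P x -> (forall i, i \in S -> coord p W x 0 i = 1) ->
        (forall i, i \notin S -> i != a -> i != b -> coord p W x 0 i = 0) ->
        coord p W x 0 a + coord p W x 0 b <= 1].

Lemma ind_setU1 (R : realType) n (S : {set 'I_n}) a : a \notin S ->
  ind R (a |: S) = ind R S + delta_mx 0 a.
Proof.
move=> aS; apply/rowP => i; rewrite !mxE !inE eqxx /=.
by case: eqVneq => [->|_] /=; rewrite ?(negPf aS) ?add0r ?addr0.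
Qed.

Lemma polytope_between (R : realType) n (P : set 'rV[R]_n) p U y d (r t : R) : polytope P ->
  P (pt p U y) -> P (pt p U (y + t *: d)) -> 0 <= r <= t -> 0 < t -> P (pt p U (y + r *: d)).
Proof.
move=> pP Py Pt /andP[r0 rt] t0.
have h : 0 <= r / t <= 1 by rewrite divr_ge0 ?(ltW t0) //= ler_pdivrMr // mul1r.
have := polytope_convex pP h Py Pt; rewrite -convex_pt.
by rewrite scalerDr scalerA divfK ?gt_eqF // addrA -scalerDl subrK scale1r.
Qed.

Lemma dot_delta (R : realType) n (a : 'I_n) (k : 'rV[R]_n) : dot (delta_mx 0 a) k = k 0 a.
Proof.
rewrite /dot (bigD1 a) //= big1 ?addr0 => [|i ia]; rewrite mxE eqxx /=.
  by rewrite eqxx mul1r.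
by rewrite (negPf ia) mul0r.
Qed.

Lemma dot_ind (R : realType) n (S : {set 'I_n}) (k : 'rV[int]_n) :
  dot (ind R S) (of_int R k) = (\sum_(i in S) k 0 i)%:~R.
Proof.
rewrite rmorph_sum /dot [RHS]big_mkcond; apply: eq_bigr => i _ /=.
by rewrite !mxE; case: (i \in S); rewrite ?mul1r ?mul0r.
Qed.

Lemma pt_neighbor (R : realType) n (p : 'rV[R]_n) U a (s : R) k y :
  pt (p + s *: row a (of_int R U)) (U + k^T *m row a U) y
  = pt p U (y + (s + dot y (of_int R k)) *: delta_mx 0 a).
Proof.
rewrite /pt of_intD of_intM of_int_row mulmxDr mulmxDl -scalemxAl -rowE mulmxA.
have -> : y *m of_int R k^T = (dot y (of_int R k))%:M.
  rewrite dotC dotE; apply/matrixP => i j; rewrite !ord1 [RHS]mxE eqxx mulr1n.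
  by congr ((_ *m _) _ _); apply/matrixP => i' j'; rewrite !mxE.
rewrite mul_scalar_mx scalerDl -!addrA; congr (_ + _).
by rewrite addrCA.
Qed.

(** The slice [y = 1] on [S], [y = 0] off [S], [a], [b] is seen from the neighbouring vertex
    along [a] as well, and ends in that direction at [y_a = t].  For [t >= 2] it is long along
    [a].  For [t = 1] its edge at the far end has direction [e_b + k_b e_a] with [k_b >= -1]:
    the value [-1] closes the slice off to a triangle, any larger value makes it contain the
    missing corner. *)
Lemma corner_or_long (R : realType) n (P : set 'rV[R]_n) p U W (S : {set 'I_n}) a b :
  smooth P -> lattice_polytope P -> vertex P p -> chart P p U W finset.set0 ->
  unit_steps P p U finset.set0 -> a != b -> a \notin S -> b \notin S ->
  ~ displaced_triangle P p U W S a b ->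
  (forall q V V' (T : {set 'I_n}), vertex P q -> chart P q V V' finset.set0 ->
     unit_steps P q V finset.set0 -> (#|T| <= #|S|.+1)%N -> P (pt q V (ind R T))) ->
  P (pt p U (ind R S + delta_mx 0 a + delta_mx 0 b)) \/
  P (pt p U (ind R S + 2 *: delta_mx 0 a)).
Proof.
move=> smP latP vp ch Ps ab aS bS notri IH.
have [pP _ _ _ _] := smP; have UW := chart_inv ch.
have [s [k [W' [ka vq ch' Ps']]]] := chart_neighbor a smP latP vp ch Ps.
set q := p + _ in vq ch' Ps'; set U' := U + _ in ch' Ps'.
pose kr := of_int R k; pose sg y := s%:R + dot y kr.
have kra : kr 0 a = -2 by rewrite mxE ka.
have ptE y : pt q U' y = pt p U (y + sg y *: delta_mx 0 a) by apply: pt_neighbor.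
have sgD y z : sg (y + z) = sg y + dot z kr by rewrite /sg dotDl addrA.
(* As [k_a = -2], the change of coordinates is an involution. *)
have ptE' z : pt p U z = pt q U' (z + sg z *: delta_mx 0 a).
  have e : sg z + (sg z + sg z * -2) = 0 by ring.
  by rewrite ptE sgD dotZl dot_delta kra -addrA -scalerDl e scale0r addr0.
have ge0 z : P (pt p U z) -> 0 <= z 0 a + sg z.
  rewrite ptE' => /(chart_ge0 ch' a); rewrite coord_pt ?(chart_inv ch') //.
  by rewrite !mxE !eqxx mulr1.
have P0 : P (pt p U (ind R S)) by apply: IH ch Ps _.
have Pa : P (pt p U (ind R S + delta_mx 0 a)).
  by rewrite -ind_setU1 //; apply: IH ch Ps _; rewrite // cardsU1 aS.
have Pb : P (pt p U (ind R S + delta_mx 0 b)).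
  by rewrite -ind_setU1 //; apply: IH ch Ps _; rewrite // cardsU1 bS.
pose t := s%:Z + \sum_(i in S) k 0 i.
have sgS : sg (ind R S) = t%:~R by rewrite /sg dot_ind /t intrD.
have Pt : P (pt p U (ind R S + t%:~R *: delta_mx 0 a)).
  by rewrite -sgS -ptE; apply: IH ch' Ps' _.
have t1 : 1 <= t.
  have := ge0 _ Pa; rewrite sgD dot_delta kra sgS !mxE !eqxx (negPf aS) /=.
  rewrite add0r -(ler_int R) => h; lra.
have [t2|t2] := leP 2 t.
  right; apply: polytope_between Pt _ _ => //.
    by rewrite (ler_int R 2 t) t2 ler0n.
  by rewrite ltr0z; lia.
have {t1 t2} tE : t = 1 by lia.
left.
have Pk : P (pt p U (ind R S + delta_mx 0 b + (1 + k 0 b)%:~R *: delta_mx 0 a)).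
  have -> : (1 + k 0 b)%:~R = sg (ind R S + delta_mx 0 b).
    by rewrite sgD dot_delta sgS tE mxE intrD.
  by rewrite -ptE -ind_setU1 //; apply: IH ch' Ps' _; rewrite // cardsU1 bS.
have k0 : 0 <= 1 + k 0 b.
  have := chart_ge0 ch a Pk; rewrite coord_pt // !mxE !eqxx (negPf aS) (negPf ab) /=.
  by rewrite mulr1 !add0r ler0z.
have [kb|kb] := eqVneq (k 0 b) (-1).
  case: notri; split=> // x Px xS x0.
  have xE : coord p W x
      = ind R S + coord p W x 0 a *: delta_mx 0 a + coord p W x 0 b *: delta_mx 0 b.
    apply/rowP => i; rewrite [RHS]mxE [X in _ = X + _]mxE.
    rewrite [X in _ = X + _ + _]mxE [X in _ = _ + X + _]mxE [X in _ = _ + X]mxE.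
    rewrite ![delta_mx _ _ _ _]mxE eqxx /=.
    have [->|ia] := eqVneq i a; first by rewrite (negPf aS) (negPf ab) mulr1 mulr0 add0r addr0.
    have [->|ib] := eqVneq i b; first by rewrite (negPf bS) mulr1 mulr0 !add0r.
    rewrite !mulr0 !addr0; have [iS|iS] := boolP (i \in S); [exact: xS|exact: x0].
  have := ge0 (coord p W x); rewrite pt_coord // => /(_ Px).
  rewrite [X in sg X]xE !sgD !dotZl !dot_delta kra sgS tE.
  have -> : kr 0 b = -1 by rewrite mxE kb.
  move: (coord _ _ _ 0 a) (coord _ _ _ 0 b) => u v h; lra.
rewrite addrAC -[X in _ + X]scale1r; apply: polytope_between Pk _ _ => //.
  by rewrite ler01 /= (ler_int R 1); lia.
by rewrite ltr0z; lia.
Qed.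

(** The points [y_a = 2] and [y_b = 2] of the slice have the missing corner as midpoint. *)
Lemma ind_corner (R : realType) n (P : set 'rV[R]_n) :
  smooth P -> lattice_polytope P ->
  (forall p U W S a b, vertex P p -> chart P p U W finset.set0 ->
     unit_steps P p U finset.set0 -> ~ displaced_triangle P p U W S a b) ->
  forall p U W S, vertex P p -> chart P p U W finset.set0 -> unit_steps P p U finset.set0 ->
    P (pt p U (ind R S)).
Proof.
move=> smP latP notri p U W S; have [m] := ubnP #|S|.
elim: m => // m IH in p U W S *; rewrite ltnS => Sm vp ch Ps.
have [S0|[b bS]] := set_0Vmem S.
  rewrite S0 (_ : ind R _ = 0) ?pt0; first exact: vertex_mem.
  by apply/rowP => i; rewrite !mxE inE.
have [S0|[a aS]] := set_0Vmem (S :\ b).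
  have -> : ind R S = delta_mx 0 b.
    rewrite -(finset.setD1K bS) S0 ind_setU1 ?inE // (_ : ind R _ = 0) ?add0r //.
    by apply/rowP => i; rewrite !mxE inE.
  by rewrite pt_delta; apply: Ps; rewrite inE.
pose T := S :\ b :\ a.
have aT : a \notin T by rewrite !inE eqxx.
have bT : b \notin T by rewrite !inE eqxx andbF.
have ab : a != b by move: aS; rewrite !inE => /andP[].
have SE : ind R S = ind R T + delta_mx 0 a + delta_mx 0 b.
  by rewrite -ind_setU1 // finset.setD1K // -ind_setU1 ?inE ?eqxx // finset.setD1K.
have Tm : (#|T|.+1 < m)%N.
  by apply: leq_trans Sm; rewrite (cardsD1 b S) bS (cardsD1 a (S :\ b)) aS.
have IH' q V V' (T' : {set 'I_n}) : vertex P q -> chart P q V V' finset.set0 ->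
    unit_steps P q V finset.set0 -> (#|T'| <= #|T|.+1)%N -> P (pt q V (ind R T')).
  by move=> vq chq Pq T'T; apply: IH vq chq Pq; apply: leq_ltn_trans Tm.
have [pP _ _ _ _] := smP.
have [|Pa] := corner_or_long smP latP vp ch Ps ab aT bT (@notri _ _ _ _ _ _ vp ch Ps) IH'.
  by rewrite SE.
have ba : b != a by rewrite eq_sym.
have [|Pb] := corner_or_long smP latP vp ch Ps ba bT aT (@notri _ _ _ _ _ _ vp ch Ps) IH'.
  by rewrite SE addrAC.
have half : 0 <= (2^-1 : R) <= 1 by rewrite invr_ge0 ler0n /= invf_le1 ?ler1n ?ltr0n.
have := polytope_convex pP half Pa Pb; rewrite -convex_pt.
congr (P (pt _ _ _)); rewrite SE; apply/rowP => i; rewrite !mxE; lra.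
Qed.

(** The unit cube is the convex hull of its 0-1 points. *)
Lemma cube_corner (R : realType) n (C : set 'rV[R]_n) :
  (forall x y t, 0 <= t <= 1 -> C x -> C y -> C ((1 - t) *: x + t *: y)) ->
  (forall S, C (ind R S)) -> forall y : 'rV[R]_n, (forall i, 0 <= y 0 i <= 1) -> C y.
Proof.
move=> convC CS y; pose frac (z : 'rV[R]_n) : {set 'I_n} :=
  [set i | (z 0 i != 0) && (z 0 i != 1)]%SET.
(* Induct on the number of coordinates other than 0 and 1. *)
have [m] := ubnP #|frac y|; elim: m => // m IH in y *; rewrite ltnS => ym y01.
have [f0|[i yi]] := finset.set_0Vmem (frac y).
  rewrite (_ : y = ind R [set i | y 0 i == 1]) //; apply/rowP => i.
  have : i \notin frac y by rewrite f0 inE.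
  rewrite mxE !inE negb_and !negbK; case: eqVneq => [-> _|_ /eqP ->].
    by rewrite eq_sym oner_eq0.
  by rewrite eqxx.
pose z c : 'rV[R]_n := \row_j (if j == i then c else y 0 j).
have Cz c : c = 0 \/ c = 1 -> C (z c).
  move=> c01; apply: IH => [|j]; last first.
    rewrite mxE; case: eqP => // _.
    by case: c01 => ->; rewrite ?ler01 ?lexx.
  apply: leq_trans ym; rewrite (cardsD1 i (frac y)) yi ltnS; apply: subset_leq_card.
  apply/fintype.subsetP => j; rewrite !inE [z c _ _]mxE.
  case: (eqVneq j i) => [_|//]; by case: c01 => ->; rewrite eqxx ?andbF.
have := convC _ _ _ (y01 i) (Cz 0 (or_introl erefl)) (Cz 1 (or_intror erefl)).
congr C; apply/rowP => j; rewrite !mxE; case: eqVneq => [->|_]; last by lra.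
by rewrite mulr0 add0r mulr1.
Qed.

Lemma deeply_smooth_of_no_triangle (R : realType) n (P : set 'rV[R]_n) :
  smooth P -> lattice_polytope P ->
  (forall p U W S a b, vertex P p -> chart P p U W finset.set0 ->
     unit_steps P p U finset.set0 -> ~ displaced_triangle P p U W S a b) ->
  deeply_smooth P.
Proof.
move=> smP latP notri v U vv fU.
have [W [ch Ps]] := chart_exists smP latP vv fU.
have [pP _ _ _ _] := smP.
move=> _ [l l01 <-]; apply: (@cube_corner _ _ (fun y => P (pt v U y))) l01.
- by move=> x y t t01 Px Py; rewrite convex_pt; apply: polytope_convex.
- by move=> S; apply: ind_corner vv ch Ps.
Qed.

(** * Displacements in deeply smooth polytopes *)

Lemma coord_displaced (R : realType) n (p : 'rV[R]_n) U W J x j : U *m W = 1%:M ->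
  coord (pt p U (ind R J)) W x 0 j = coord p W x 0 j - (j \in J)%:R.
Proof.
move=> UW; have -> : coord (pt p U (ind R J)) W x = coord p W x - coord p W (pt p U (ind R J)).
  by rewrite /coord -mulmxBl opprB addrA subrK.
by rewrite coord_pt // [LHS]mxE; congr (_ + _); rewrite !mxE.
Qed.

Lemma chart_displaced (R : realType) n (P : set 'rV[R]_n) p U W J : chart P p U W finset.set0 ->
  P (pt p U (ind R J)) -> chart (slice P p W J 1) (pt p U (ind R J)) U W J.
Proof.
move=> [UW Pp P0 _] PJ; split=> //.
- by split=> // j jJ; rewrite coord_pt // mxE jJ.
- move=> x j [Px hx]; rewrite coord_displaced //.
  by case: (boolP (j \in J)) => jJ; [rewrite hx ?subrr|rewrite subr0 P0].
- by move=> x j [_ hx] jJ; rewrite coord_displaced // hx // jJ subrr.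
Qed.

Lemma smooth_chart (R : realType) n (P : set 'rV[R]_n) p :
  smooth P -> lattice_polytope P -> vertex P p ->
  exists U W, [/\ edge_frame P p U, chart P p U W finset.set0 & unit_steps P p U finset.set0].
Proof.
move=> smP latP vp; have [_ _ _ _ /(_ _ vp) [U fU _]] := smP.
by have [W [ch Ps]] := chart_exists smP latP vp fU; exists U, W.
Qed.

(** A vertex of the face of [F] selected by [c] gives one chart for both [F] and [D]: same
    basis, same frozen coordinates, base points differing by a corner of the parallelepiped. *)
Lemma displacement_chart (R : realType) n (P F D : set 'rV[R]_n) c :
  smooth P -> lattice_polytope P -> deeply_smooth P -> face P F -> first_displacement P F D ->
  exists p q U W (J : {set 'I_n}),
    [/\ chart F p U W J /\ unit_steps F p U J, chart D q U W J /\ unit_steps D q U J,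
        forall j, j \notin J -> dot c (row j (of_int R U)) <= 0,
        forall K : {set 'I_n}, J \subset K -> D (pt q U (ind R (K :\: J)))
      & exists z, q = of_int R z].
Proof.
move=> smP latP deep fF dF; have [pP _ _ _ _] := smP.
have F0 : F !=set0 by case: fF.
have [v vF [Fv vc]] := argmax_vertex c (face_polytope pP fF) F0.
have vP := face_trans pP fF vF.
have [U [W [fU ch Ps]]] := smooth_chart smP latP vP.
have UW := chart_inv ch.
have [J [FE DE]] := displacement_slice ch Ps dF Fv.
have cube K : P (pt v U (ind R K)).
  apply: (deep _ _ vP fU); exists (ind R K) => // i.
  by rewrite mxE ler0n lern1 leq_b1.
have DK (K : {set 'I_n}) : J \subset K -> D (pt (pt v U (ind R J)) U (ind R (K :\: J))).
  move=> /fintype.subsetP JK.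
  have -> : pt (pt v U (ind R J)) U (ind R (K :\: J)) = pt v U (ind R K).
    rewrite /pt -addrA -mulmxDl; congr (_ + _ *m _); apply/rowP => i; rewrite !mxE !inE.
    have [iJ|iJ] := boolP (i \in J); last by rewrite add0r.
    by rewrite (JK _ iJ) addr0.
  by rewrite DE; split=> // j jJ; rewrite coord_pt // mxE JK.
have chF : chart F v U W J by rewrite FE; apply: chart_slice.
have sF : unit_steps F v U J by rewrite FE; apply: unit_steps_slice.
exists v, (pt v U (ind R J)), U, W, J; split=> //.
- split; first by rewrite DE; apply: chart_displaced.
  move=> j jJ; rewrite -pt_delta.
  have := DK _ (finset.subsetUr [set j] J).
  congr (D (pt _ _ _)); apply/rowP => i; rewrite !mxE !inE eqxx /=.
  by case: eqVneq => [->|_] /=; rewrite ?jJ // andNb.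
- by move=> j jJ; have := vc _ (sF _ jJ); rewrite dotDr gerDl.
- have [vz ->] := latP.2 _ vP.
  exists (vz + (\row_j (j \in J)%:R) *m U).
  rewrite of_intD of_intM /pt; congr (_ + _ *m _).
  by apply/rowP => j; rewrite !mxE; case: (j \in J).
Qed.

Lemma deeply_smooth_fan (R : realType) n (P F D : set 'rV[R]_n) :
  smooth P -> lattice_polytope P -> deeply_smooth P -> face P F -> first_displacement P F D ->
  normally_isomorphic D F.
Proof.
move=> smP latP deep fF dF.
have key c : [/\ face F (argmax F c), face D (argmax D c)
    & normal_cone D (argmax D c) = normal_cone F (argmax F c)].
  have [p [q [U [W [J [[chF sF] [chD sD] cU _ _]]]]]] := displacement_chart c smP latP deep fF dF.
  split; last by rewrite (normal_cone_chart chF sF cU) (normal_cone_chart chD sD cU).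
  - by apply/faceP; split; [exists p; apply: chart_base (chart_argmax chF cU)|exists c].
  - by apply/faceP; split; [exists q; apply: chart_base (chart_argmax chD cU)|exists c].
apply/seteqP; split=> N /= [H /faceP [_ [c ->]] <-]; have [fFc fDc NE] := key c.
- by exists (argmax F c).
- by exists (argmax D c).
Qed.

(** * Unimodular triangles *)

Lemma sum_ord2 (V : nmodType) (g : 'I_2 -> V) : \sum_i g i = g 0 + g 1.
Proof. by rewrite big_ord_recl big_ord1; congr (_ + g _); apply: val_inj. Qed.

Lemma triangle_hull (R : realType) n (a : 'rV[int]_n) (U : 'M[int]_(2, n)) x :
  hull (of_int R (col_mx a (\matrix_i (a + row i U)))) x <->
  exists r : 'rV[R]_2, [/\ forall i, 0 <= r 0 i, \sum_i r 0 i <= 1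
                        & x = of_int R a + r *m of_int R U].
Proof.
have E (l : 'rV[R]_(1 + 2)) : \sum_i l 0 i = 1 ->
    l *m of_int R (col_mx a (\matrix_i (a + row i U)))
    = of_int R a + rsubmx l *m of_int R U.
  rewrite big_split_ord big_ord1 /= => l1.
  rewrite -{1}[l]hsubmxK /of_int map_col_mx mul_row_col mulmx_sum_row big_ord1 row_id.
  have -> : map_mx intr (\matrix_i (a + row i U))
      = const_mx 1 *m map_mx intr a + map_mx intr U :> 'M[R]_(2, n).
    apply/matrixP => i j; rewrite !mxE big_ord1 !mxE mul1r.
    by rewrite -intrD.
  rewrite mulmxDr mulmxA addrA; congr (_ + _).
  have -> : rsubmx l *m const_mx 1 = (\sum_(i < 2) l 0 (rshift 1 i))%:M.
    apply/matrixP => i j; rewrite !ord1 !mxE mulr1n.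
    by apply: eq_bigr => k _; rewrite !mxE mulr1.
  rewrite mul_scalar_mx -scalerDl mxE l1 scale1r //.
split=> [[l [l0 l1] <-]|[r [r0 r1 ->]]].
  exists (rsubmx l); split; last exact: E.
    by move=> i; rewrite mxE.
  move: l1; rewrite big_split_ord big_ord1 /= => <-.
  by under eq_bigr do rewrite mxE; rewrite lerDr.
pose l : 'rV[R]_(1 + 2) := row_mx (1 - \sum_i r 0 i)%:M r.
have l1 : \sum_i l 0 i = 1.
  rewrite big_split_ord big_ord1 /= row_mxEl mxE mulr1n.
  by under [X in _ + X]eq_bigr do rewrite row_mxEr; rewrite subrK.
exists l; last by rewrite E // row_mxKr.
split=> // i; rewrite -[i]splitK; case: (split i) => k /=.
  by rewrite row_mxEl !ord1 mxE mulr1n subr_ge0.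
by rewrite row_mxEr.
Qed.

(** A unimodular triangle has only three lattice points, a proper parallelogram has four. *)
Lemma unimodular_triangle_parallelogram (R : realType) n (T : set 'rV[R]_n)
    (z e f : 'rV[int]_n) :
  unimodular_triangle T -> has_dim T 2 ->
  T (of_int R z) -> T (of_int R (z + e)) -> T (of_int R (z + f)) ->
  T (of_int R (z + e + f)) -> e = 0 \/ f = 0.
Proof.
move=> [a [U [TE [_ LU]]]] [_ [V [fV hV]]].
have TP x : T x <-> exists r : 'rV[R]_2, [/\ forall i, 0 <= r 0 i, \sum_i r 0 i <= 1
                        & x = of_int R a + r *m of_int R U].
  by rewrite TE; apply: triangle_hull.
have fU : row_free (of_int R U).
  rewrite /row_free eqn_leq rank_leq_row -{1}(eqP fV) mxrankS //.
  rewrite -(genmxE (of_int R U)); apply/hV => x y /TP[r [_ _ ->]] /TP[s [_ _ ->]].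
  by rewrite genmxE opprD addrACA subrr add0r -mulmxBl submxMl.
have key x : T (of_int R x) -> exists c : 'rV[int]_2,
    [/\ 0 <= c 0 0, 0 <= c 0 1, c 0 0 + c 0 1 <= 1 & c *m U = x - a].
  move=> /TP[r [r0 r1 xr]].
  have xa : of_int R (x - a) = r *m of_int R U by rewrite of_intB xr addrC addKr.
  have [|c [cE _]] := LU (x - a); first by rewrite /= xa submxMl.
  have rc : r = of_int R c by apply: (row_free_inj fU); rewrite -of_intM cE xa.
  exists c; split=> //.
  - by have := r0 0; rewrite rc mxE ler0z.
  - by have := r0 1; rewrite rc mxE ler0z.
  - move: r1; by rewrite rc sum_ord2 !mxE -intrD (ler_int R _ 1).
move=> /key[c1 [p1 q1 r1 E1]] /key[c2 [p2 q2 r2 E2]] /key[c3 [p3 q3 r3 E3]] /key[c4 [p4 q4 r4 E4]].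
have c0 : c1 + c4 = c2 + c3.
  apply: (@of_int_inj R); apply: (row_free_inj fU); rewrite -!of_intM !mulmxDl E1 E2 E3 E4.
  by congr (of_int R _); rewrite !addrA; apply/rowP => i; rewrite !mxE; ring.
have c0E (i : 'I_2) : c1 0 i + c4 0 i = c2 0 i + c3 0 i.
  by have := congr1 (fun c : 'rV_2 => c 0 i) c0; rewrite !mxE.
have eq2 (c d : 'rV[int]_2) : c 0 0 = d 0 0 -> c 0 1 = d 0 1 -> c = d.
  move=> h0 h1; apply/rowP => i; case: (unliftP 0 i) => [k|] ->; last exact: h0.
  by rewrite ord1 (_ : lift 0 0 = 1) //; apply: val_inj.
have [[h0 h1]|[h0 h1]] :
    (c1 0 0 = c2 0 0 /\ c1 0 1 = c2 0 1) \/ (c1 0 0 = c3 0 0 /\ c1 0 1 = c3 0 1).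
  move: (c0E 0) (c0E 1) p1 q1 r1 p2 q2 r2 p3 q3 r3 p4 q4 r4.
  move: (c1 0 0) (c1 0 1) (c2 0 0) (c2 0 1) (c3 0 0) (c3 0 1) (c4 0 0) (c4 0 1).
  lia.
- left; have h12 := eq2 _ _ h0 h1.
  by apply: (addrI (z - a)); rewrite addr0 [LHS]addrAC -E2 -E1 h12.
- right; have h13 := eq2 _ _ h0 h1.
  by apply: (addrI (z - a)); rewrite addr0 [LHS]addrAC -E3 -E1 h13.
Qed.

Lemma row_neq0 n (U W : 'M[int]_n) j : U *m W = 1%:M -> row j U != 0.
Proof.
move=> UW; apply/eqP => U0; have := congr1 (fun A : 'M_n => A j j) UW.
have -> : (U *m W) j j = (row j U *m W) 0 j by rewrite -row_mul [RHS]mxE.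
by rewrite U0 mul0mx !mxE eqxx => /eqP; rewrite eq_sym oner_eq0.
Qed.

Lemma deeply_smooth_ut_free (R : realType) n (P F D : set 'rV[R]_n) :
  smooth P -> lattice_polytope P -> deeply_smooth P -> face P F -> first_displacement P F D ->
  ut_free D.
Proof.
move=> smP latP deep fF dF T /faceP[_ [c TE]] dT uT.
have [p [q [U [W [J [_ [ch st] cU DK [z zE]]]]]]] := displacement_chart c smP latP deep fF dF.
have UW := chart_inv ch.
have chT := chart_argmax ch cU; have stT := unit_steps_argmax ch st cU.
rewrite -TE in chT stT; set J' := J :|: _ in chT stT.
have /eqP/cards2P[a [b [ab abE]]] := has_dim_uniq (chart_dim chT stT) dT.
have aJ : a \notin J' by have := finset.set21 a b; rewrite -abE inE.
have bJ : b \notin J' by have := finset.set22 a b; rewrite -abE inE.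
have Tq := chart_base chT; have Ta := stT _ aJ; have Tb := stT _ bJ.
have [aJ0 bJ0] : a \notin J /\ b \notin J.
  by move: aJ bJ; rewrite !inE !negb_or => /andP[? _] /andP[? _].
have Tab : T (q + row a (of_int R U) + row b (of_int R U)).
  rewrite TE (argmax_chart ch cU).
  have -> : q + row a (of_int R U) + row b (of_int R U) = pt q U (ind R [set a; b]).
    rewrite finset.setUC ind_setU1 ?inE 1?eq_sym //.
    have -> : ind R [set a] = delta_mx 0 a by apply/rowP => i; rewrite !mxE inE eqxx.
    by rewrite /pt mulmxDl -!rowE addrA.
  split.
    have := DK _ (finset.subsetUr [set a; b] J); congr (D (pt _ _ (ind R _))).
    apply/setP => i; rewrite !inE; have [iJ|_] := boolP (i \in J); last by rewrite orbF.
    by apply/esym/negbTE/norP; split; apply: contraTneq iJ => ->.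
  move=> j jJ cj; rewrite coord_pt // mxE !inE.
  have jJ' : j \in J' by rewrite !inE cj orbT.
  by case: eqVneq jJ' aJ => [->->//|_ jJ' _]; case: eqVneq jJ' bJ => [->->|].
have [] := @unimodular_triangle_parallelogram _ _ T z (row a U) (row b U) uT dT.
- by rewrite -zE.
- by rewrite of_intD of_int_row -zE.
- by rewrite of_intD of_int_row -zE.
- by rewrite !of_intD !of_int_row -zE.
- by apply/eqP/(row_neq0 _ UW).
- by apply/eqP/(row_neq0 _ UW).
Qed.

(** * Displaced triangles are obstructions *)

(** The face [y = 0] on [S] and [a] has an edge at [p] in the direction [b], which its first
    displacement shrinks to a point; so the functional [- y_b] enters a cone of the normal fan
    from which the edge excludes it. *)
Lemma triangle_fan (R : realType) n (P : set 'rV[R]_n) p U W (S : {set 'I_n}) a b :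
  chart P p U W finset.set0 -> unit_steps P p U finset.set0 ->
  displaced_triangle P p U W S a b ->
  ~ normally_isomorphic (slice P p W (a |: S) 1) (slice P p W (a |: S) 0).
Proof.
move=> ch Ps [[ab aS bS] [_ Pa _] tri] NI; have UW := chart_inv ch.
pose J := a |: S; pose K := ~: (b |: J).
have bJ : b \notin J by rewrite !inE negb_or eq_sym ab.
have chF := chart_slice J ch; have stF : unit_steps (slice P p W J 0) p U J.
  exact: unit_steps_slice.
have chD : chart (slice P p W J 1) (pt p U (ind R J)) U W J.
  by apply: chart_displaced; rewrite // ind_setU1.
pose c : 'rV[R]_n := dual W (- ind R K).
have cU j : dot c (row j (of_int R U)) = - (j \in K)%:R by rewrite dot_dual_ind.
have c0 j : j \notin J -> dot c (row j (of_int R U)) <= 0 by rewrite cU oppr_le0 ler0n.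
have : normal_fan (slice P p W J 0) (normal_cone (slice P p W J 0) (argmax (slice P p W J 0) c)).
  exists (argmax (slice P p W J 0) c) => //; apply/faceP; split; last by exists c.
  by exists p; apply: chart_base (chart_argmax chF c0).
rewrite -NI => -[H /faceP[[x0 Hx0] [d HE]] NE].
have HD x : H x -> slice P p W J 1 x by rewrite HE => -[].
have : normal_cone (slice P p W J 1) H c by rewrite NE => x y [_ hx]; apply: hx.
move=> cN.
(* [H] is contained in the part of the displacement selected by [c], on which [y_a = 1];
   there [y_a + y_b <= 1] leaves only [y_b = 0]. *)
have Hb x : H x -> coord p W x 0 b <= 0.
  move=> Hx; have Dx := HD _ Hx.
  have : argmax (slice P p W J 1) c x by split=> // z Dz; apply: cN.
  rewrite (argmax_chart chD c0) => -[[Px xJ] xK].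
  have xa : coord p W x 0 a = 1 by apply: xJ; rewrite !inE eqxx.
  have := tri x Px; rewrite xa gerDl; apply.
    by move=> i iS; apply: xJ; rewrite !inE iS orbT.
  move=> i iS ia ib.
  have iJ : i \notin J by rewrite !inE negb_or ia.
  have := xK i iJ; rewrite coord_displaced // (negPf iJ) subr0; apply.
  by rewrite cU !inE negb_or ib negb_or ia iS oppr_lt0 ltr01.
pose e : 'rV[R]_n := dual W (- ind R [set b]).
have eE y : dot e y = dot e p - coord p W y 0 b.
  rewrite (dot_coord p e y UW) (bigD1 b) //= big1 ?addr0 => [|i ib].
    by rewrite dot_dual_ind // inE eqxx mulrN1.
  by rewrite dot_dual_ind // inE (negPf ib) oppr0 mulr0.
have : normal_cone (slice P p W J 1) H e.
  move=> x y /Hb xb [Py _]; rewrite (eE x) (eE y) lerD2l lerN2.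
  exact: le_trans xb (chart_ge0 ch b Py).
rewrite NE (normal_cone_chart chF stF c0) => /(_ b bJ) [_].
rewrite cU !inE eqxx oppr0 => /(_ erefl) /eqP.
by rewrite dot_dual_ind // inE eqxx oppr_eq0 oner_eq0.
Qed.

Lemma hull_sub (R : realType) m n (A : 'M[R]_(m, n)) (P : set 'rV[R]_n) : polytope P ->
  (forall i, P (row i A)) -> hull A `<=` P.
Proof.
move=> [k [B ->]] BA _ [l [l0 l1] <-].
have /(@choice _ _ _) [L hL] : forall i, exists r : 'rV[R]_k,
    ((forall j, 0 <= r 0 j) /\ \sum_j r 0 j = 1) /\ r *m B = row i A.
  by move=> i; have [r r01 rE] := BA i; exists r.
exists (l *m \matrix_i L i); last first.
  rewrite -mulmxA; congr (_ *m _); apply/row_matrixP => i.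
  by rewrite row_mul rowK; case: (hL i).
split=> [j|].
  by rewrite mxE sumr_ge0 // => i _; rewrite mxE mulr_ge0 //; case: (hL i) => -[].
under eq_bigr do rewrite mxE.
rewrite exchange_big /= -[RHS]l1; apply: eq_bigr => i _.
under eq_bigr do rewrite mxE.
by rewrite -mulr_sumr; case: (hL i) => -[_ ->] _; rewrite mulr1.
Qed.

Lemma lattice_basis_rows (R : realType) n k (U : 'M[int]_(k, n)) (X : 'M[int]_(n, k)) :
  U *m X = 1%:M -> lattice_basis [set w | (of_int R w <= of_int R U)%MS] U.
Proof.
move=> UX; split=> [i|w /submxP[r wr]]; first by rewrite /= of_int_row row_sub.
exists (w *m X); split=> [|c <-]; last by rewrite -mulmxA UX mulmx1.
apply: (@of_int_inj R); rewrite of_intM of_intM wr -[r *m _ *m _]mulmxA -of_intM UX.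
by rewrite of_int1 mulmx1.
Qed.

Lemma triangle_ut (R : realType) n (P : set 'rV[R]_n) p U W (S : {set 'I_n}) a b :
  polytope P -> (exists z, p = of_int R z) ->
  chart P p U W finset.set0 -> displaced_triangle P p U W S a b ->
  ~ ut_free (slice P p W S 1).
Proof.
move=> pP [z pz] ch [[ab aS bS] [P0 Pa Pb] tri] UT; have UW := chart_inv ch.
have chD := chart_displaced ch P0.
set D := slice P p W S 1 in UT chD; set q := pt p U (ind R S) in chD.
pose c : 'rV[R]_n := dual W (- ind R (~: (a |: (b |: S)))).
have cU j : dot c (row j (of_int R U)) = - (j \in ~: (a |: (b |: S)))%:R.
  by rewrite dot_dual_ind.
have c0 j : j \notin S -> dot c (row j (of_int R U)) <= 0 by rewrite cU oppr_le0 ler0n.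
have chT := chart_argmax chD c0; set T := argmax D c in chT.
have TE x : T x <-> P x /\ forall i, i != a -> i != b -> coord q W x 0 i = 0.
  rewrite /T (argmax_chart chD c0); split=> [[[Px xS] xc]|[Px xc]].
    split=> // i ia ib; have [iS|iS] := boolP (i \in S).
      by rewrite coord_displaced // xS // iS subrr.
    by apply: xc => //; rewrite cU !inE !negb_or ia ib iS oppr_lt0 ltr01.
  split=> [|i iS].
    split=> // i iS; have := xc i; rewrite coord_displaced // iS => h.
    by apply/eqP; rewrite -subr_eq0; apply/eqP/h; apply: contraTneq iS => ->.
  rewrite cU !inE !negb_or iS andbT oppr_lt0 ltr0n lt0b => /andP[]; exact: xc.
have qE : q = of_int R (z + (\row_j (j \in S)%:R) *m U).
  rewrite of_intD of_intM /q /pt pz; congr (_ + _ *m _).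
  by apply/rowP => j; rewrite !mxE; case: (j \in S).
have step j : pt p U (ind R S + delta_mx 0 j) = q + row j (of_int R U).
  by rewrite /q /pt mulmxDl addrA -rowE.
have Tq : T q := chart_base chT.
have Ta : T (q + row a (of_int R U)).
  apply/TE; split; first by rewrite -step.
  by move=> i ia ib; rewrite coord_step // eq_sym (negPf ia).
have Tb : T (q + row b (of_int R U)).
  apply/TE; split; first by rewrite -step.
  by move=> i ia ib; rewrite coord_step // eq_sym (negPf ib).
have fT : face D T by apply/faceP; split; [exists q|exists c].
have dT : has_dim T 2.
  set J := S :|: _ in chT.
  have JE : ~: J = [set a; b]%SET.
    apply/setP => i; rewrite !inE cU oppr_lt0 ltr0n lt0b !inE.
    have [->|ia] /= := eqVneq i a; first by rewrite (negPf aS).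
    by have [->|ib] /= := eqVneq i b; [rewrite (negPf bS)|case: (i \in S)].
  have <- : #|~: J| = 2%N by rewrite JE cards2 ab.
  apply: chart_dim chT _ => j jJ.
  have : j \in ~: J by rewrite inE.
  by rewrite JE !inE => /orP[] /eqP ->.
apply: UT fT dT _.
pose f (i : 'I_2) : 'I_n := if i == 0 then a else b.
have fI : injective f.
  move=> i j; rewrite /f; case: (unliftP 0 i) => [i'|] ->; case: (unliftP 0 j) => [j'|] -> //=.
  - by rewrite !ord1.
  - by move=> /eqP; rewrite eq_sym (negPf ab).
  - by move=> /eqP; rewrite (negPf ab).
pose V : 'M[int]_(2, n) := \matrix_i row (f i) U.
have VX : V *m (\matrix_(j, i) W j (f i)) = 1%:M.
  apply/matrixP => i j; rewrite !mxE.
  have := congr1 (fun A : 'M_n => A (f i) (f j)) UW; rewrite !mxE (inj_eq fI) => <-.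
  by apply: eq_bigr => k _; rewrite !mxE.
exists (z + (\row_j (j \in S)%:R) *m U), V; split; last exact: lattice_basis_rows VX.
have rV2 (r : 'rV[R]_2) :
    r *m of_int R V = r 0 0 *: row a (of_int R U) + r 0 1 *: row b (of_int R U).
  by rewrite mulmx_sum_row sum_ord2 -!of_int_row !rowK.
apply/seteqP; split=> x.
- move=> /TE [Px xc]; apply/triangle_hull; rewrite -qE.
  have xa0 : 0 <= coord p W x 0 a by exact: (chart_ge0 ch _ Px).
  have xb0 : 0 <= coord p W x 0 b by exact: (chart_ge0 ch _ Px).
  exists (\row_i coord q W x 0 (f i)); split.
  + by move=> i; rewrite mxE coord_displaced // /f; case: ifP => _;
      rewrite ?(negPf aS) ?(negPf bS) subr0.
  + rewrite sum_ord2 ![(\row_i _) _ _]mxE /f /= !coord_displaced // (negPf aS) (negPf bS) !subr0.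
    apply: tri => // i iS.
      have ia : i != a by apply: contraTneq iS => ->.
      have ib : i != b by apply: contraTneq iS => ->.
      by apply/eqP; rewrite -subr_eq0 -[1]/(true%:R) -iS -(coord_displaced p S x i UW) xc.
    by move=> ia ib; have := xc i ia ib; rewrite coord_displaced // (negPf iS) subr0.
  + rewrite rV2 ![(\row_i _) _ _]mxE /f /= -[LHS](pt_coord q x UW) /pt mulmx_sum_row.
    rewrite (bigD1 a) //= (bigD1 b) ?(eq_sym b) //= big1 ?addr0 // => i /andP[ia ib].
    by rewrite xc // scale0r.
- move=> hx; apply/TE; split.
    move: x hx; apply: hull_sub => // i.
    rewrite -of_int_row; have [Pq _] := (TE _).1 Tq.
    have [PTa _] := (TE _).1 Ta; have [PTb _] := (TE _).1 Tb.
    rewrite -[i]splitK; case: (split i) => k /=.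
      by rewrite rowKu row_id -qE.
    rewrite rowKd rowK of_intD -qE rowK /f of_int_row.
    by case: ifP.
  have /triangle_hull [r [_ _ ->]] := hx.
  move=> i ia ib; rewrite -qE rV2.
  have -> : q + (r 0 0 *: row a (of_int R U) + r 0 1 *: row b (of_int R U))
      = pt q U (r 0 0 *: delta_mx 0 a + r 0 1 *: delta_mx 0 b).
    by rewrite /pt mulmxDl -!scalemxAl -!rowE.
  by rewrite coord_pt // !mxE (negPf ia) (negPf ib) !andbF !mulr0 addr0.
Qed.

(** [P] is the face cut out by no facet at all. *)
Lemma displacement_self (R : realType) n (P : set 'rV[R]_n) :
  smooth P -> lattice_polytope P -> face P P /\ first_displacement P P P.
Proof.
move=> smP latP; have [pP [P0 _] _ _ _] := smP.
have [v vv] := vertex_exists pP P0.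
have [U [W [_ ch Ps]]] := smooth_chart smP latP vv.
have E t : slice P v W finset.set0 t = P.
  by apply/seteqP; split=> [x []|x Px] //; split=> // j; rewrite inE.
have := slice_displacement finset.set0 ch Ps; have := slice_face finset.set0 ch.
by rewrite !E.
Qed.

Theorem theorem4p10 (R : realType) (n : nat) (P : set 'rV[R]_n)
    (P_smooth : smooth P) (P_lattice : lattice_polytope P) :
  [<-> deeply_smooth P;
       forall F D, face P F -> first_displacement P F D -> normally_isomorphic D F;
       ut_free P /\
       forall F D, face P F -> first_displacement P F D -> ut_free D].
Proof.
have fan_deep : (forall F D, face P F -> first_displacement P F D -> normally_isomorphic D F) ->
    deeply_smooth P.
  move=> NI; apply: deeply_smooth_of_no_triangle => // p U W S a b _ ch Ps tri.
  apply: (triangle_fan ch Ps tri); apply: NI; first exact: slice_face ch.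
  exact: slice_displacement ch Ps.
tfae.
- by move=> deep F D; apply: deeply_smooth_fan.
- move=> /fan_deep deep.
  have ut F D : face P F -> first_displacement P F D -> ut_free D.
    exact: deeply_smooth_ut_free.
  by split=> //; have [fP dP] := displacement_self P_smooth P_lattice; apply: ut fP dP.
- move=> [_ ut]; apply: deeply_smooth_of_no_triangle => // p U W S a b vp ch Ps tri.
  apply: (triangle_ut P_lattice.1 (P_lattice.2 _ vp) ch tri).
  by apply: ut (slice_face S ch) (slice_displacement S ch Ps).
Qed.
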